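(* Let $k$ be a real number with $0<k^2<1$. Then $$\sum_{n=0}^{\infty} (-1)^{\lfloor n/2\rfloor}(2n+1)\,\operatorname{csch}^2\!\left(\frac{2n+1}{2}\,\frac{K'}{K}\,\pi\right) = \frac{2k(k^2-1)K^2\left(\dfrac{\left(\sqrt{1-k}+\sqrt{1+k}\right)\left(E+(k^2-1)K\right)}{k(k^2-1)}-\dfrac12\left(\dfrac{1}{\sqrt{1+k}}-\dfrac{1}{\sqrt{1-k}}\right)K\right)}{\pi^2\left(E'K+(E-K)K'\right)}.$$
   Context: For the elliptic modulus $k$ (with $0<k^2<1$), write $k'=\sqrt{1-k^2}$. The complete elliptic integrals of the first and second kind are $K=K(k)=\int_0^{\pi/2}\frac{d\theta}{\sqrt{1-k^2\sin^2\theta}}$ and $E=E(k)=\int_0^{\pi/2}\sqrt{1-k^2\sin^2\theta}\,d\theta$; also $K'=K(k')$ and $E'=E(k')$. Here $\operatorname{csch} x = 1/\sinh x$. *)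

(* Defs.v *)
From Stdlib Require Export Reals.
From Coquelicot Require Export Coquelicot.

Local Open Scope R_scope.

(* [k] is the modulus (not the parameter m = k^2); for k^2 < 1 both integrands
   are continuous on [0, PI/2], so the total operator [RInt] is the Riemann
   integral there. *)
Definition ellK (k : R) : R :=
  RInt (fun theta => 1 / sqrt (1 - k ^ 2 * sin theta ^ 2)) 0 (PI / 2).

Definition ellE (k : R) : R :=
  RInt (fun theta => sqrt (1 - k ^ 2 * sin theta ^ 2)) 0 (PI / 2).

Definition comp_modulus (k : R) : R := sqrt (1 - k ^ 2).

Definition csch (x : R) : R := 1 / sinh x.

(* Main.v *)
Require Import Defs.
From Stdlib Require Import Reals Ranalysis5 ZArith List Lia Lra.
From Stdlib Require Import Classical ClassicalEpsilon FunctionalExtensionality.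
From Stdlib Require FinFun.
From Coquelicot Require Import Coquelicot.
Import ListNotations.
Local Open Scope R_scope.

(** Let q = exp (- PI K'/K) be the nome of the modulus k, and let chi (n) be the sign
    (-1)^(n/2), which depends on 2n+1 as the quadratic character modulo 8 attached to
    the field generated by the square root of -2. The series of the statement is, up to
    a constant factor, the derivative with respect to t = K'/K of the Lambert series
      F = 1 + 2 sum chi(n) q^(2n+1) / (1 - q^(2n+1)),   q = exp (- PI t),
    because the derivative of coth is - csch^2. The proof evaluates F in closed form and
    differentiates both sides with respect to k.

    Closed form. F counts representations by the form x^2 + 2 y^2:
    F(q) = phi(q) phi(q^2), where phi(q) is the sum of q^(n^2) over the integers
    ([lam_eq]). Folding the Lambert series gives F(q) = 2 sum q^n / (1 + q^(4n)) over the
    integers ([lam_lambert]). Multiplying this bilateral sum by a theta series and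
    collecting the terms of equal degree yields a multiple of a theta series
    ([psi_mul_lam]); the unknown factor is the same for q and - q and cancels in the ratio
    F(-q) / F(q) = phi(-q) / phi(q) ([lam_opp]). Since both F(q) + F(-q) and
    phi(q) + phi(-q) are expressed by values at powers of q, the quotient of F(q) by
    phi(q) phi(q^2) is unchanged under q -> q^2, and it tends to 1 as q -> 0.

    Theta functions and periods. The squares of phi(q) and phi(-q) follow the
    arithmetic-geometric mean under q -> q^2, and Landen's substitution shows that the
    elliptic integral is invariant under the same step ([ellI_landen]); hence
    K = (PI/2) phi(q)^2 for the modulus k(q) built from theta functions ([ellI_AB]). The
    integral giving K' doubles under q -> q^2, and its logarithmic growth near q = 0 then
    identifies it as - (ln q) / 2 times the same factor ([ellI_AC]). As K'/K is strictly
    decreasing in k, every k is the modulus of its own nome ([theta_modulus_nome]).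
    Together, F = K (sqrt (1+k) + sqrt (1-k)) / PI ([lam_nome]).

    Differentiation. The derivatives of K and K' are the classical combinations of K, E
    and K', E' ([ellK_derive], [ratio_derive]), the Lambert series may be differentiated
    term by term ([lam_exp_derive]), and the chain rule gives the formula. The denominator
    E'K + (E - K)K' is the numerator of the derivative of K'/K up to sign. The case of
    negative k follows because both sides are even in k. *)

(** * Unordered sums *)

Definition lsum {I : Type} (f : I -> R) (l : list I) : R :=
  fold_right (fun i s => f i + s) 0 l.

(** Convergence along the finite lists without repetition, ordered by inclusion. *)
Definition has_sum {I : Type} (f : I -> R) (s : R) : Prop :=
  forall eps, 0 < eps -> exists l0, forall l, NoDup l -> incl l0 l ->
    Rabs (lsum f l - s) < eps.

Definition summable {I : Type} (f : I -> R) : Prop :=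
  exists M, forall l, NoDup l -> lsum (fun i => Rabs (f i)) l <= M.

Definition usum {I : Type} (f : I -> R) : R := epsilon (inhabits 0) (has_sum f).

Definition classical_eq_dec (I : Type) (x y : I) : {x = y} + {x <> y} :=
  excluded_middle_informative (x = y).

Definition dedup {I : Type} : list I -> list I := nodup (classical_eq_dec I).

Lemma NoDup_dedup {I} (l : list I) : NoDup (dedup l).
Proof. apply NoDup_nodup. Qed.

Lemma incl_dedup {I} (l : list I) : incl l (dedup l).
Proof. intros x Hx. now apply nodup_In. Qed.

Lemma lsum_ext {I} (f g : I -> R) l :
  (forall i, In i l -> f i = g i) -> lsum f l = lsum g l.
Proof.
  induction l as [|a l IH]; intros H; simpl; trivial.
  rewrite (H a (or_introl eq_refl)), IH; trivial.
  intros i Hi; apply H; now right.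
Qed.

Lemma lsum_plus {I} (f g : I -> R) l :
  lsum (fun i => f i + g i) l = lsum f l + lsum g l.
Proof. induction l as [|a l IH]; simpl; [|rewrite IH]; lra. Qed.

Lemma lsum_scal {I} c (f : I -> R) l : lsum (fun i => c * f i) l = c * lsum f l.
Proof. induction l as [|a l IH]; simpl; [|rewrite IH]; lra. Qed.

Lemma lsum_app {I} (f : I -> R) l1 l2 : lsum f (l1 ++ l2) = lsum f l1 + lsum f l2.
Proof. induction l1 as [|a l IH]; simpl; [|rewrite IH]; lra. Qed.

Lemma lsum_map {I J} (e : I -> J) (f : J -> R) l :
  lsum f (map e l) = lsum (fun i => f (e i)) l.
Proof. induction l as [|a l IH]; simpl; [|rewrite IH]; lra. Qed.

Lemma lsum_le {I} (f g : I -> R) l :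
  (forall i, f i <= g i) -> lsum f l <= lsum g l.
Proof.
  intros H; induction l as [|a l IH]; simpl; [lra|].
  specialize (H a); lra.
Qed.

Lemma lsum_nonneg {I} (f : I -> R) l : (forall i, 0 <= f i) -> 0 <= lsum f l.
Proof.
  intros H; induction l as [|a l IH]; simpl; [lra|]. specialize (H a); lra.
Qed.

Lemma lsum_abs {I} (f : I -> R) l : Rabs (lsum f l) <= lsum (fun i => Rabs (f i)) l.
Proof.
  induction l as [|a l IH]; simpl; [rewrite Rabs_R0; lra|].
  eapply Rle_trans; [apply Rabs_triang|]. lra.
Qed.

Lemma lsum_incl {I} (f : I -> R) l l' :
  (forall i, 0 <= f i) -> NoDup l -> incl l l' -> lsum f l <= lsum f l'.
Proof.
  intros H; revert l'; induction l as [|a l IH]; intros l' Hd Hi; simpl.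
  - now apply lsum_nonneg.
  - inversion_clear Hd as [|? ? Ha Hl].
    destruct (in_split a l') as (l1 & l2 & ->); [apply Hi; now left|].
    assert (H1 : lsum f l <= lsum f (l1 ++ l2)).
    { apply IH; trivial. intros x Hx.
      assert (Hx' := Hi x (or_intror Hx)).
      apply in_app_or in Hx'. apply in_or_app.
      destruct Hx' as [Hx'|[Hx'|Hx']]; auto. now subst. }
    rewrite lsum_app in *. simpl. lra.
Qed.

Lemma has_sum_unique {I} (f : I -> R) s t : has_sum f s -> has_sum f t -> s = t.
Proof.
  intros Hs Ht.
  destruct (Req_dec s t) as [|Hn]; trivial. exfalso.
  assert (He : 0 < Rabs (s - t) / 2).
  { apply Rdiv_lt_0_compat; [apply Rabs_pos_lt; lra|lra]. }
  destruct (Hs _ He) as (l1 & H1), (Ht _ He) as (l2 & H2).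
  specialize (H1 (dedup (l1 ++ l2)) (NoDup_dedup _)).
  specialize (H2 (dedup (l1 ++ l2)) (NoDup_dedup _)).
  assert (H1' := H1 (fun x Hx => incl_dedup _ _ (in_or_app _ _ _ (or_introl Hx)))).
  assert (H2' := H2 (fun x Hx => incl_dedup _ _ (in_or_app _ _ _ (or_intror Hx)))).
  clear H1 H2. revert H1' H2' He. set (u := lsum _ _). clearbody u.
  unfold Rabs; repeat destruct Rcase_abs; lra.
Qed.

Lemma usum_eq {I} (f : I -> R) s : has_sum f s -> usum f = s.
Proof.
  intros H. apply (has_sum_unique f); trivial.
  unfold usum. apply epsilon_spec. now exists s.
Qed.

Lemma has_sum_plus {I} (f g : I -> R) s t :
  has_sum f s -> has_sum g t -> has_sum (fun i => f i + g i) (s + t).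
Proof.
  intros Hf Hg e He.
  destruct (Hf (e / 2)) as (l1 & H1); [lra|].
  destruct (Hg (e / 2)) as (l2 & H2); [lra|].
  exists (l1 ++ l2); intros l Hd Hi. apply incl_app_inv in Hi as [Hi1 Hi2].
  specialize (H1 l Hd Hi1). specialize (H2 l Hd Hi2).
  rewrite lsum_plus.
  replace (_ - _) with ((lsum f l - s) + (lsum g l - t)) by ring.
  eapply Rle_lt_trans; [apply Rabs_triang|]. lra.
Qed.

Lemma has_sum_scal {I} c (f : I -> R) s :
  has_sum f s -> has_sum (fun i => c * f i) (c * s).
Proof.
  intros Hf e He.
  assert (Hc : 0 < Rabs c + 1) by (assert (H := Rabs_pos c); lra).
  destruct (Hf (e / (Rabs c + 1))) as (l1 & H1); [now apply Rdiv_lt_0_compat|].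
  exists l1; intros l Hd Hi. specialize (H1 l Hd Hi).
  rewrite lsum_scal, <- Rmult_minus_distr_l, Rabs_mult.
  apply Rle_lt_trans with ((Rabs c + 1) * Rabs (lsum f l - s)).
  - apply Rmult_le_compat_r; [apply Rabs_pos|lra].
  - apply Rmult_lt_compat_l with (r := Rabs c + 1) in H1; trivial.
    replace ((Rabs c + 1) * (e / (Rabs c + 1))) with e in H1 by (field; lra).
    exact H1.
Qed.

Lemma has_sum_nonneg_bounded {I} (f : I -> R) M :
  (forall i, 0 <= f i) -> (forall l, NoDup l -> lsum f l <= M) ->
  exists s, has_sum f s.
Proof.
  intros H0 HM.
  destruct (completeness (fun y => exists l, NoDup l /\ y = lsum f l)) as (s & Hub & Hlub).
  - exists M. intros y (l & Hl & ->); auto.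
  - exists 0, []. split; [constructor|reflexivity].
  - exists s. intros e He.
    destruct (classic (exists l, NoDup l /\ s - e < lsum f l)) as [(l0 & Hd0 & Hl0)|Hn].
    + exists l0. intros l Hd Hi.
      assert (H1 := lsum_incl f l0 l H0 Hd0 Hi).
      assert (H2 : lsum f l <= s) by (apply Hub; now exists l).
      apply Rabs_lt_between; lra.
    + assert (s <= s - e); [|lra].
      apply Hlub. intros y (l & Hl & ->).
      destruct (Rle_lt_dec (lsum f l) (s - e)); trivial.
      exfalso; apply Hn; now exists l.
Qed.

Lemma has_sum_usum {I} (f : I -> R) : summable f -> has_sum f (usum f).
Proof.
  intros (M & HM).
  assert (Hex : exists s, has_sum f s).
  { destruct (has_sum_nonneg_bounded (fun i => Rmax (f i) 0) M) as (s & Hs).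
    - intros i; apply Rmax_r.
    - intros l Hl. eapply Rle_trans; [|apply HM, Hl]. apply lsum_le.
      intros i. apply Rmax_lub; [apply Rle_abs|apply Rabs_pos].
    - destruct (has_sum_nonneg_bounded (fun i => Rmax (- f i) 0) M) as (t & Ht).
      + intros i; apply Rmax_r.
      + intros l Hl. eapply Rle_trans; [|apply HM, Hl]. apply lsum_le.
        intros i. apply Rmax_lub; [rewrite <- Rabs_Ropp; apply Rle_abs|apply Rabs_pos].
      + exists (s + (-1) * t).
        replace f with (fun i => Rmax (f i) 0 + (-1) * Rmax (- f i) 0).
        * apply has_sum_plus; trivial. now apply has_sum_scal.
        * apply functional_extensionality; intros i.
          unfold Rmax; repeat destruct Rle_dec; lra. }
  unfold usum. now apply epsilon_spec.
Qed.

Lemma usum_ext {I} (f g : I -> R) : (forall i, f i = g i) -> usum f = usum g.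
Proof. intros H. f_equal. now apply functional_extensionality. Qed.

Lemma summable_ext {I} (f g : I -> R) :
  (forall i, f i = g i) -> summable f -> summable g.
Proof. intros H. now replace g with f by now apply functional_extensionality. Qed.

Lemma summable_le {I} (f g : I -> R) :
  (forall i, Rabs (f i) <= g i) -> summable g -> summable f.
Proof.
  intros H (M & HM). exists M. intros l Hl. eapply Rle_trans; [|apply HM, Hl].
  apply lsum_le. intros i. eapply Rle_trans; [apply H|apply Rle_abs].
Qed.

Lemma summable_scal {I} c (f : I -> R) : summable f -> summable (fun i => c * f i).
Proof.
  intros (M & HM). exists (Rabs c * M). intros l Hl.
  rewrite (lsum_ext _ (fun i => Rabs c * Rabs (f i))).
  - rewrite lsum_scal. apply Rmult_le_compat_l; [apply Rabs_pos|auto].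
  - intros; apply Rabs_mult.
Qed.

Lemma summable_plus {I} (f g : I -> R) :
  summable f -> summable g -> summable (fun i => f i + g i).
Proof.
  intros (M & HM) (N & HN). exists (M + N). intros l Hl.
  apply Rle_trans with (lsum (fun i => Rabs (f i) + Rabs (g i)) l).
  - apply lsum_le; intros; apply Rabs_triang.
  - rewrite lsum_plus. specialize (HM l Hl). specialize (HN l Hl). lra.
Qed.

Lemma usum_plus {I} (f g : I -> R) :
  summable f -> summable g -> usum (fun i => f i + g i) = usum f + usum g.
Proof. intros; apply usum_eq, has_sum_plus; now apply has_sum_usum. Qed.

Lemma usum_scal {I} c (f : I -> R) :
  summable f -> usum (fun i => c * f i) = c * usum f.
Proof. intros; apply usum_eq, has_sum_scal; now apply has_sum_usum. Qed.

Lemma usum_bound {I} (f : I -> R) M :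
  (forall l, NoDup l -> lsum (fun i => Rabs (f i)) l <= M) -> Rabs (usum f) <= M.
Proof.
  intros H. assert (Hs : summable f) by now exists M.
  apply Rnot_lt_le; intros Hlt.
  destruct (has_sum_usum f Hs (Rabs (usum f) - M)) as (l0 & Hl0); [lra|].
  specialize (Hl0 (dedup l0) (NoDup_dedup _) (incl_dedup _)).
  specialize (H (dedup l0) (NoDup_dedup _)).
  assert (H1 := lsum_abs f (dedup l0)).
  revert H Hl0 H1 Hlt. set (u := lsum f _). set (v := lsum _ _). clearbody u v.
  unfold Rabs; repeat destruct Rcase_abs; lra.
Qed.

Lemma usum_le {I} (f g : I -> R) :
  summable f -> summable g -> (forall i, f i <= g i) -> usum f <= usum g.
Proof.
  intros Hf Hg Hle. apply Rnot_lt_le; intros Hlt.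
  assert (He : 0 < (usum f - usum g) / 2) by lra.
  destruct (has_sum_usum f Hf _ He) as (l1 & H1).
  destruct (has_sum_usum g Hg _ He) as (l2 & H2).
  specialize (H1 (dedup (l1 ++ l2)) (NoDup_dedup _)
    (fun x Hx => incl_dedup _ _ (in_or_app _ _ _ (or_introl Hx)))).
  specialize (H2 (dedup (l1 ++ l2)) (NoDup_dedup _)
    (fun x Hx => incl_dedup _ _ (in_or_app _ _ _ (or_intror Hx)))).
  assert (H3 := lsum_le f g (dedup (l1 ++ l2)) Hle).
  apply Rabs_lt_between in H1. apply Rabs_lt_between in H2. lra.
Qed.

Lemma usum_ge_term {I} (f : I -> R) i :
  summable f -> (forall j, 0 <= f j) -> f i <= usum f.
Proof.
  intros Hf H0. apply Rnot_lt_le; intros Hlt.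
  destruct (has_sum_usum f Hf (f i - usum f)) as (l0 & Hl0); [lra|].
  specialize (Hl0 (dedup (i :: l0)) (NoDup_dedup _)
    (fun x Hx => incl_dedup (i :: l0) x (or_intror Hx))).
  assert (H1 : lsum f [i] <= lsum f (dedup (i :: l0))).
  { apply lsum_incl; trivial. repeat constructor; intros [].
    intros x [<-|[]]. apply incl_dedup. now left. }
  change (lsum f [i]) with (f i + 0) in H1. apply Rabs_lt_between in Hl0. lra.
Qed.

Lemma NoDup_map_inj {I J} (e : I -> J) l :
  (forall x y, e x = e y -> x = y) -> NoDup l -> NoDup (map e l).
Proof. intros H. apply FinFun.Injective_map_NoDup. exact H. Qed.

(** Finite sums over [J] pull back along [e], the indices outside its image
    contributing nothing. *)
Lemma preimage_list {I J} (e : I -> J) (f : J -> R) l :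
  (forall x y, e x = e y -> x = y) ->
  (forall j, (forall i, e i <> j) -> f j = 0) -> NoDup l ->
  exists l', NoDup l' /\ lsum (fun i => f (e i)) l' = lsum f l
    /\ (forall i, In i l' <-> In (e i) l).
Proof.
  intros Hinj H0. induction l as [|j l IH]; intros Hd.
  - exists []. repeat split; trivial; constructor.
  - inversion_clear Hd as [|? ? Hj Hl]. destruct (IH Hl) as (l' & Hd' & Hs & Hin).
    destruct (classic (exists i, e i = j)) as [(i & Hi)|Hn].
    + exists (i :: l'). repeat split.
      * constructor; trivial. rewrite Hin, Hi. exact Hj.
      * simpl. now rewrite Hs, Hi.
      * intros [->|Hx]; [now left|right; now apply Hin].
      * intros [Hx|Hx]; [left; apply Hinj; congruence|right; now apply Hin].
    + exists l'. repeat split; trivial.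
      * simpl. rewrite H0, Hs; [lra|]. intros i Hi; apply Hn; now exists i.
      * intros Hx; right; now apply Hin.
      * intros [Hx|Hx]; [exfalso; apply Hn; now exists i|now apply Hin].
Qed.

Lemma has_sum_embed {I J} (e : I -> J) (f : J -> R) s :
  (forall x y, e x = e y -> x = y) ->
  (forall j, (forall i, e i <> j) -> f j = 0) ->
  has_sum (fun i => f (e i)) s -> has_sum f s.
Proof.
  intros Hinj H0 H eps He. destruct (H eps He) as (l0 & Hl0).
  exists (map e l0). intros l Hd Hi.
  destruct (preimage_list e f l Hinj H0 Hd) as (l' & Hd' & Hs & Hin).
  rewrite <- Hs. apply Hl0; trivial.
  intros i Hx. apply Hin, Hi. now apply in_map.
Qed.

Lemma summable_comp {I J} (e : I -> J) (f : J -> R) :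
  (forall x y, e x = e y -> x = y) -> summable f -> summable (fun i => f (e i)).
Proof.
  intros Hinj (M & HM). exists M. intros l Hl.
  rewrite <- (lsum_map e (fun j => Rabs (f j))). apply HM. now apply NoDup_map_inj.
Qed.

(** Reindexing along an injection outside the image of which the terms vanish.
    Bijections are the most frequent case, but splitting a sum by parity classes
    also takes this form. *)
Lemma usum_embed {I J} (e : I -> J) (f : J -> R) :
  (forall x y, e x = e y -> x = y) ->
  (forall j, (forall i, e i <> j) -> f j = 0) -> summable f ->
  usum f = usum (fun i => f (e i)).
Proof.
  intros Hinj H0 Hs. apply usum_eq, (has_sum_embed e); trivial.
  apply has_sum_usum. now apply summable_comp.
Qed.

Lemma usum_bij {I J} (e : I -> J) (d : J -> I) (f : J -> R) :
  (forall i, d (e i) = i) -> (forall j, e (d j) = j) -> summable f ->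
  usum f = usum (fun i => f (e i)).
Proof.
  intros H1 H2. apply usum_embed.
  - intros x y H. now rewrite <- (H1 x), H, H1.
  - intros j Hj. exfalso. now apply (Hj (d j)).
Qed.

Lemma summable_prod {I J} (f : I -> R) (g : J -> R) :
  summable f -> summable g -> summable (fun p : I * J => f (fst p) * g (snd p)).
Proof.
  intros (M & HM) (N & HN). exists (M * N). intros l Hl.
  set (l1 := dedup (map fst l)). set (l2 := dedup (map snd l)).
  apply Rle_trans with
    (lsum (fun p => Rabs (f (fst p) * g (snd p))) (list_prod l1 l2)).
  - apply lsum_incl; trivial.
    + intros; apply Rabs_pos.
    + intros [i j] Hp. apply in_prod; apply incl_dedup.
      * now apply (in_map fst) in Hp.
      * now apply (in_map snd) in Hp.
  - assert (H : forall l1, lsum (fun p => Rabs (f (fst p) * g (snd p))) (list_prod l1 l2)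
      = lsum (fun i => Rabs (f i)) l1 * lsum (fun j => Rabs (g j)) l2).
    { clear. intros l1; induction l1 as [|i l1 IH]; simpl; [lra|].
      rewrite lsum_app, IH, lsum_map. simpl.
      rewrite (lsum_ext _ (fun j => Rabs (f i) * Rabs (g j)))
        by (intros; apply Rabs_mult).
      rewrite lsum_scal. ring. }
    rewrite H. apply Rmult_le_compat.
    + apply lsum_nonneg; intros; apply Rabs_pos.
    + apply lsum_nonneg; intros; apply Rabs_pos.
    + apply HM, NoDup_dedup.
    + apply HN, NoDup_dedup.
Qed.

Lemma summable_row {I J} (f : I * J -> R) i :
  summable f -> summable (fun j => f (i, j)).
Proof. apply (summable_comp (fun j => (i, j))). congruence. Qed.

(** Over finitely many rows, the row sums are approximated by a finite list of
    pairs that can be required to contain any prescribed pairs of these rows. *)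
Lemma rows_approx {I J} (f : I * J -> R) (l0 : list (I * J)) l :
  summable f -> NoDup l -> forall eps, 0 < eps ->
  exists L, NoDup L /\ (forall p, In p L -> In (fst p) l)
    /\ (forall p, In p l0 -> In (fst p) l -> In p L)
    /\ Rabs (lsum f L - lsum (fun i => usum (fun j => f (i, j))) l) < eps.
Proof.
  intros Hs. induction l as [|i l IH]; intros Hd eps He.
  - exists []. simpl. rewrite Rminus_0_r, Rabs_R0. repeat split; trivial; constructor.
  - inversion_clear Hd as [|? ? Hi Hl].
    destruct (IH Hl (eps / 2)) as (L & HL1 & HL2 & HL3 & HL4); [lra|].
    destruct (has_sum_usum _ (summable_row f i Hs) (eps / 2)) as (m0 & Hm0); [lra|].
    set (m := dedup (m0 ++ map snd l0)).
    assert (Hm : Rabs (lsum (fun j => f (i, j)) m - usum (fun j => f (i, j))) < eps / 2).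
    { apply Hm0; [apply NoDup_dedup|]. intros x Hx.
      apply incl_dedup, in_or_app; now left. }
    exists (map (pair i) m ++ L). repeat split.
    + apply NoDup_app; trivial.
      * apply NoDup_map_inj; [congruence|apply NoDup_dedup].
      * intros p Hp Hp'. apply HL2 in Hp'. apply in_map_iff in Hp as (j & <- & _).
        now apply Hi.
    + intros p Hp. apply in_app_or in Hp as [Hp|Hp].
      * apply in_map_iff in Hp as (j & <- & _). now left.
      * right. now apply HL2.
    + intros [i' j] Hp [Hp'|Hp']; apply in_or_app.
      * left. simpl in Hp'. subst i'. apply in_map, incl_dedup, in_or_app. right.
        now apply (in_map snd) in Hp.
      * right. now apply HL3.
    + rewrite lsum_app, lsum_map. simpl.
      replace (_ - _) with ((lsum (fun j => f (i, j)) m - usum (fun j => f (i, j)))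
        + (lsum f L - lsum (fun i => usum (fun j => f (i, j))) l)) by ring.
      eapply Rle_lt_trans; [apply Rabs_triang|]. lra.
Qed.

(** No convergence of the row sums has to be assumed: [rows_approx] compares each of
    their finite sums with a finite sum of the double family. *)
Lemma usum_fubini {I J} (f : I * J -> R) :
  summable f -> usum f = usum (fun i => usum (fun j => f (i, j))).
Proof.
  intros Hs. symmetry. apply usum_eq. intros eps He.
  destruct (has_sum_usum f Hs (eps / 2)) as (l0 & Hl0); [lra|].
  exists (map fst l0). intros l Hd Hi.
  destruct (rows_approx f l0 l Hs Hd (eps / 2)) as (L & HL1 & HL2 & HL3 & HL4); [lra|].
  assert (H : Rabs (lsum f L - usum f) < eps / 2).
  { apply Hl0; trivial. intros p Hp. apply HL3; trivial. apply Hi. now apply in_map. }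
  revert H HL4. set (u := lsum f L). set (v := lsum _ l). set (w := usum f).
  clearbody u v w. unfold Rabs; repeat destruct Rcase_abs; lra.
Qed.

Lemma usum_swap {I J} (f : I -> J -> R) :
  summable (fun p => f (fst p) (snd p)) ->
  usum (fun i => usum (fun j => f i j)) = usum (fun j => usum (fun i => f i j)).
Proof.
  intros Hs. transitivity (usum (fun p : I * J => f (fst p) (snd p)));
    [symmetry; apply (usum_fubini _ Hs)|].
  set (e := fun p : J * I => (snd p, fst p)).
  rewrite (usum_bij e (fun p => (snd p, fst p)) _); trivial;
    [|now intros []|now intros []].
  rewrite usum_fubini; trivial.
  apply (summable_comp e) in Hs; [exact Hs|].
  intros [x1 x2] [y1 y2]; unfold e; simpl; congruence.
Qed.

Lemma usum_mult {I J} (f : I -> R) (g : J -> R) :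
  summable f -> summable g ->
  usum f * usum g = usum (fun p : I * J => f (fst p) * g (snd p)).
Proof.
  intros Hf Hg. rewrite usum_fubini by now apply summable_prod. simpl.
  rewrite Rmult_comm, <- usum_scal by trivial. apply usum_ext. intros i.
  rewrite usum_scal by trivial. ring.
Qed.

Lemma usum_nat_is_series (f : nat -> R) : summable f -> is_series f (usum f).
Proof.
  intros Hs.
  assert (H : is_lim_seq (sum_n f) (usum f)).
  { apply is_lim_seq_spec. intros eps.
    destruct (has_sum_usum f Hs eps (cond_pos eps)) as (l0 & Hl0).
    exists (list_max l0). intros n Hn.
    replace (sum_n f n) with (lsum f (seq 0 (S n))).
    - apply Hl0; [apply seq_NoDup|]. intros x Hx. apply in_seq.
      assert (Hm := proj1 (list_max_le l0 (list_max l0)) (le_n _)).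
      rewrite Forall_forall in Hm. specialize (Hm x Hx). lia.
    - clear. induction n as [|n IH].
      + rewrite sum_O. simpl. ring.
      + rewrite sum_Sn, <- IH, seq_S, lsum_app. simpl. unfold plus; simpl. ring. }
  exact H.
Qed.

Lemma usum_nat_Series (f : nat -> R) : summable f -> usum f = Series f.
Proof. intros H. symmetry. now apply is_series_unique, usum_nat_is_series. Qed.

(** * Sums over the integers *)

Lemma lsum_geom r N : 0 <= r < 1 -> lsum (fun n => r ^ n) (seq 0 N) <= / (1 - r).
Proof.
  intros Hr. assert (H : lsum (fun n => r ^ n) (seq 0 N) = (1 - r ^ N) / (1 - r)).
  { induction N as [|N IH].
    - simpl. field. lra.
    - rewrite seq_S, lsum_app, IH. simpl. field. lra. }
  rewrite H. assert (0 <= r ^ N) by (apply pow_le; lra).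
  rewrite <- (Rmult_1_l (/ _)). apply Rmult_le_compat_r; [|lra].
  left; apply Rinv_0_lt_compat; lra.
Qed.

Lemma le_list_max (l : list nat) n : In n l -> (n <= list_max l)%nat.
Proof.
  intros Hn. assert (Hm := proj1 (list_max_le l (list_max l)) (le_n _)).
  rewrite Forall_forall in Hm. auto.
Qed.

Lemma lsum_geom_bound (f : nat -> R) c r l :
  0 <= c -> 0 <= r < 1 -> (forall n, Rabs (f n) <= c * r ^ n) -> NoDup l ->
  lsum (fun n => Rabs (f n)) l <= c / (1 - r).
Proof.
  intros Hc Hr Hf Hl.
  apply Rle_trans with (lsum (fun n => c * r ^ n) (seq 0 (S (list_max l)))).
  - eapply Rle_trans; [apply lsum_le, Hf|]. apply lsum_incl; trivial.
    + intros; apply Rmult_le_pos; [lra|apply pow_le; lra].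
    + intros n Hn. apply in_seq. apply le_list_max in Hn. lia.
  - rewrite lsum_scal. apply Rmult_le_compat_l; trivial. now apply lsum_geom.
Qed.

Lemma summable_nat_geom (f : nat -> R) c r :
  0 <= c -> 0 <= r < 1 -> (forall n, Rabs (f n) <= c * r ^ n) -> summable f.
Proof. intros. exists (c / (1 - r)). intros. now apply lsum_geom_bound. Qed.

Lemma summable_Z_geom (f : Z -> R) c r :
  0 <= c -> 0 <= r < 1 -> (forall n, Rabs (f n) <= c * r ^ Z.abs_nat n) -> summable f.
Proof.
  intros Hc Hr Hf. exists (c * (/ (1 - r) + / (1 - r))). intros l Hl.
  set (N := S (list_max (map Z.abs_nat l))).
  apply Rle_trans with (lsum (fun n => c * r ^ Z.abs_nat n)
    (map Z.of_nat (seq 0 N) ++ map (fun n => (- Z.of_nat n)%Z) (seq 0 N))).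
  - eapply Rle_trans; [apply lsum_le, Hf|]. apply lsum_incl; trivial.
    + intros; apply Rmult_le_pos; [lra|apply pow_le; lra].
    + intros n Hn. apply (in_map Z.abs_nat), le_list_max in Hn.
      apply in_or_app. destruct (Z_le_gt_dec 0 n) as [H|H]; [left|right];
        apply in_map_iff; exists (Z.abs_nat n); split; try (apply in_seq; lia); lia.
  - rewrite lsum_scal, lsum_app, !lsum_map. apply Rmult_le_compat_l; trivial.
    apply Rplus_le_compat; (eapply Rle_trans; [right|now apply (lsum_geom r N)]);
      apply lsum_ext; intros; f_equal; lia.
Qed.

Lemma usum_single {I} (f : I -> R) i : (forall j, j <> i -> f j = 0) -> usum f = f i.
Proof.
  intros H. assert (H0 : forall l, ~ In i l -> lsum f l = 0).
  { induction l as [|j l IH]; intros Hn; simpl; trivial.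
    rewrite H, IH; [lra|..]; intros Hx; apply Hn; [now right|left; congruence]. }
  apply usum_eq. intros e He. exists [i]. intros l Hd Hi.
  destruct (in_split i l) as (l1 & l2 & ->); [apply Hi; now left|].
  apply NoDup_remove_2 in Hd.
  rewrite lsum_app. simpl. rewrite !H0;
    try (intros Hx; apply Hd, in_or_app; auto).
  replace (_ - _) with 0 by ring. now rewrite Rabs_R0.
Qed.

Lemma usum_Z_fold (f : Z -> R) : summable f ->
  usum f = f 0%Z + usum (fun n => f (Z.of_nat (S n)) + f (- Z.of_nat (S n))%Z).
Proof.
  intros Hs.
  assert (Hp : summable (fun n => f (Z.of_nat (S n))))
    by (apply (summable_comp (fun n => Z.of_nat (S n))); [intros; lia|trivial]).
  assert (Hn : summable (fun n => f (- Z.of_nat (S n))%Z))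
    by (apply (summable_comp (fun n => (- Z.of_nat (S n))%Z)); [intros; lia|trivial]).
  rewrite usum_plus by trivial.
  set (f0 := fun n : Z => if (n =? 0)%Z then f n else 0).
  set (fp := fun n : Z => if (0 <? n)%Z then f n else 0).
  set (fn := fun n : Z => if (n <? 0)%Z then f n else 0).
  assert (Hle : forall g : Z -> R, (forall n, g n = f n \/ g n = 0) -> summable g).
  { intros g Hg. apply (summable_le _ (fun n => Rabs (f n))).
    - intros n. destruct (Hg n) as [->| ->]; [lra|]. rewrite Rabs_R0. apply Rabs_pos.
    - destruct Hs as (M & HM). exists M. intros l Hl.
      erewrite lsum_ext; [apply (HM l Hl)|]. intros; apply Rabs_Rabsolu. }
  assert (H0 : summable f0) by (apply Hle; intros n; unfold f0; destruct Z.eqb; auto).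
  assert (H1 : summable fp) by (apply Hle; intros n; unfold fp; destruct Z.ltb; auto).
  assert (H2 : summable fn) by (apply Hle; intros n; unfold fn; destruct Z.ltb; auto).
  rewrite (usum_ext f (fun n => f0 n + (fp n + fn n))).
  2:{ intros n; unfold f0, fp, fn; cbv beta.
      destruct (Z.eqb_spec n 0), (Z.ltb_spec 0 n), (Z.ltb_spec n 0); try lia; simpl; lra. }
  rewrite !usum_plus; trivial; [|now apply summable_plus]. f_equal; [|f_equal].
  - apply (usum_single f0 0%Z). intros n Hn0. unfold f0.
    destruct (Z.eqb_spec n 0); trivial. exfalso; lia.
  - apply (usum_embed (fun n => Z.of_nat (S n)) fp); trivial; [intros; lia|].
    intros n Hn'. unfold fp. destruct (Z.ltb_spec 0 n); trivial.
    exfalso. apply (Hn' (Z.to_nat (n - 1))). lia.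
  - apply (usum_embed (fun n => - Z.of_nat (S n))%Z fn); trivial; [intros; lia|].
    intros n Hn'. unfold fn. destruct (Z.ltb_spec n 0); trivial.
    exfalso. apply (Hn' (Z.to_nat (- n - 1))). lia.
Qed.

(** Used as r -> 0, where the central term dominates. *)
Lemma usum_Z_near (f : Z -> R) c r :
  0 <= c -> 0 <= r < 1 -> (forall n, Rabs (f n) <= c * r ^ Z.abs_nat n) ->
  Rabs (usum f - f 0%Z) <= 2 * c * r / (1 - r).
Proof.
  intros Hc Hr Hf. rewrite usum_Z_fold by now apply (summable_Z_geom _ c r).
  replace (_ - _) with (usum (fun n => f (Z.of_nat (S n)) + f (- Z.of_nat (S n))%Z)) by ring.
  apply usum_bound. intros l Hl. apply (lsum_geom_bound _ (2 * c * r) r); trivial.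
  - apply Rmult_le_pos; lra.
  - intros n. eapply Rle_trans; [apply Rabs_triang|].
    assert (H1 := Hf (Z.of_nat (S n))). assert (H2 := Hf (- Z.of_nat (S n))%Z).
    replace (Z.abs_nat (Z.of_nat (S n))) with (S n) in H1 by lia.
    replace (Z.abs_nat (- Z.of_nat (S n))) with (S n) in H2 by lia.
    simpl pow in H1, H2. lra.
Qed.

(** * Powers and signs *)

Lemma pow_range q n : 0 < q < 1 -> 0 < q ^ S n < 1.
Proof.
  intros Hq. induction n as [|n IH]; simpl in *; [lra|]. nra.
Qed.

Lemma pow_le_pow q m n : 0 < q < 1 -> (m <= n)%nat -> q ^ n <= q ^ m.
Proof.
  intros Hq Hmn. replace n with (m + (n - m))%nat by lia. rewrite pow_add.
  rewrite <- (Rmult_1_r (q ^ m)) at 2. apply Rmult_le_compat_l; [apply pow_le; lra|].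
  rewrite <- (pow1 (n - m)). apply pow_incr; lra.
Qed.

Lemma powerRZ_abs_le q n e : 0 < Rabs q < 1 -> (Z.abs n <= e)%Z ->
  Rabs (powerRZ q e) <= Rabs q ^ Z.abs_nat n.
Proof.
  intros Hq He. replace e with (Z.of_nat (Z.to_nat e)) by lia.
  rewrite <- pow_powerRZ, <- RPow_abs.
  replace (Z.to_nat e) with (Z.abs_nat n + (Z.to_nat e - Z.abs_nat n))%nat by lia.
  rewrite pow_add. rewrite <- (Rmult_1_r (_ ^ Z.abs_nat n)) at 2.
  apply Rmult_le_compat_l; [apply pow_le; lra|].
  rewrite <- (pow1 (Z.to_nat e - Z.abs_nat n)). apply pow_incr; lra.
Qed.

Lemma powerRZ_sqr q n : powerRZ (q ^ 2) n = powerRZ q (2 * n).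
Proof.
  destruct (Req_dec q 0) as [->|Hq].
  - destruct n as [|p|p]; simpl; trivial; rewrite ?Pos2Nat.inj_xO;
      rewrite ?Rmult_0_l, !pow_i; trivial; lia.
  - replace (2 * n)%Z with (n + n)%Z by lia. rewrite powerRZ_add by trivial.
    rewrite <- powerRZ_mult. f_equal. ring.
Qed.

Definition sgZ (n : Z) : R := powerRZ (-1) n.

Lemma sgZ_even n : sgZ n = if Z.even n then 1 else -1.
Proof.
  unfold sgZ. assert (H : forall m, powerRZ (-1) (2 * m) = 1).
  { intros m. rewrite <- powerRZ_sqr. replace ((-1) ^ 2) with 1 by ring.
    apply powerRZ_R1. }
  destruct (Z.even n) eqn:He.
  - apply Z.even_spec in He as (m & ->). apply H.
  - assert (Ho : Z.odd n = true) by (rewrite <- Z.negb_even, He; trivial).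
    apply Z.odd_spec in Ho as (m & ->).
    rewrite powerRZ_add, H by lra. simpl. ring.
Qed.

Lemma powerRZ_opp q n : powerRZ (- q) n = sgZ n * powerRZ q n.
Proof. unfold sgZ. rewrite <- powerRZ_mult. f_equal. ring. Qed.

Lemma sgZ_plus m n : sgZ (m + n) = sgZ m * sgZ n.
Proof. apply powerRZ_add. lra. Qed.

Lemma sgZ_abs n : Rabs (sgZ n) = 1.
Proof.
  rewrite sgZ_even. destruct Z.even; [apply Rabs_R1|].
  unfold Rabs; destruct Rcase_abs; lra.
Qed.

Ltac sign_parity :=
  rewrite ?sgZ_even;
  repeat rewrite ?Z.even_add, ?Z.even_sub, ?Z.even_mul, ?Z.even_opp; simpl Z.even.

(** * Theta series *)

Definition phi (q : R) : R := usum (fun n : Z => powerRZ q (n * n)).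

(** The exponents run once through the triangular numbers 0, 1, 3, 6, ... *)
Definition psi (q : R) : R := usum (fun n : Z => powerRZ q (2 * n * n - n)).

(** The admissible bases of the bilateral series; negative q are included since the
    proofs compare the values at q and - q. *)
Definition base (q : R) : Prop := 0 < Rabs q < 1.

Lemma base_neq q : base q -> q <> 0.
Proof. intros [H _] ->. rewrite Rabs_R0 in H. lra. Qed.

Lemma base_opp q : base q -> base (- q).
Proof. unfold base. now rewrite Rabs_Ropp. Qed.

Lemma base_sqr q : base q -> base (q ^ 2).
Proof.
  unfold base. intros H. rewrite <- RPow_abs. simpl. nra.
Qed.

Lemma base_pos q : 0 < q < 1 -> base q.
Proof. unfold base. intros H. rewrite Rabs_right; lra. Qed.

Lemma phi_bound q n : base q -> Rabs (powerRZ q (n * n)) <= 1 * Rabs q ^ Z.abs_nat n.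
Proof. intros H. rewrite Rmult_1_l. apply powerRZ_abs_le; trivial. nia. Qed.

Lemma psi_bound q n : base q ->
  Rabs (powerRZ q (2 * n * n - n)) <= 1 * Rabs q ^ Z.abs_nat n.
Proof. intros H. rewrite Rmult_1_l. apply powerRZ_abs_le; trivial. nia. Qed.

Lemma phi_summable q : base q -> summable (fun n : Z => powerRZ q (n * n)).
Proof.
  intros H. apply (summable_Z_geom _ 1 (Rabs q)); [lra|unfold base in H; lra|].
  intros; now apply phi_bound.
Qed.

Lemma psi_summable q : base q -> summable (fun n : Z => powerRZ q (2 * n * n - n)).
Proof.
  intros H. apply (summable_Z_geom _ 1 (Rabs q)); [lra|unfold base in H; lra|].
  intros; now apply psi_bound.
Qed.

(** The pairs of equal parity are those of the form (m + n, m - n). *)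
Lemma usum_same_parity (G : Z * Z -> R) : summable G ->
  usum (fun p => if Z.even (fst p + snd p) then G p else 0)
  = usum (fun p => G (fst p + snd p, fst p - snd p)%Z).
Proof.
  intros Hs. rewrite (usum_embed (fun p => (fst p + snd p, fst p - snd p)%Z)).
  - apply usum_ext. intros [m n]. simpl.
    replace (m + n + (m - n))%Z with (2 * m)%Z by ring. now rewrite Z.even_mul.
  - intros [a b] [c d]. simpl. intros H. injection H; intros. f_equal; lia.
  - intros [a b] H. simpl. destruct (Z.even (a + b)) eqn:He; trivial. exfalso.
    apply Z.even_spec in He as (m & Hm). apply (H (m, a - m)%Z). simpl. f_equal; lia.
  - apply (summable_le _ (fun p => Rabs (G p))).
    + intros p. destruct Z.even; [lra|]. rewrite Rabs_R0. apply Rabs_pos.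
    + destruct Hs as (M & HM). exists M. intros l Hl.
      erewrite lsum_ext; [apply (HM l Hl)|]. intros; apply Rabs_Rabsolu.
Qed.

(** In the double sum over (a, b) the pairs of opposite parity cancel against their
    transposes; the others are (m + n, m - n), and the quadratic form a^2 + b^2
    becomes 2 m^2 + 2 n^2. *)
Lemma phi_mul_opp q : base q -> phi q * phi (- q) = phi (- q ^ 2) ^ 2.
Proof.
  intros Hq. assert (Hq0 := base_neq q Hq).
  assert (Hs := summable_prod _ _ (phi_summable q Hq) (phi_summable _ (base_opp _ Hq))).
  assert (Hs' := summable_prod _ _ (phi_summable _ (base_opp _ Hq)) (phi_summable q Hq)).
  assert (Hc : phi q * phi (- q) = phi (- q) * phi q) by ring.
  unfold phi in *.
  replace (usum (fun n => powerRZ q (n * n)) * usum (fun n => powerRZ (- q) (n * n)))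
    with (/ 2 * (usum (fun n => powerRZ q (n * n)) * usum (fun n => powerRZ (- q) (n * n))
      + usum (fun n => powerRZ (- q) (n * n)) * usum (fun n => powerRZ q (n * n)))) by lra.
  rewrite !usum_mult by (apply phi_summable; trivial; now apply base_opp).
  rewrite <- usum_plus, <- usum_scal; trivial; [|now apply summable_plus].
  replace (usum (fun n => powerRZ (- q ^ 2) (n * n)) ^ 2) with
    (usum (fun n => powerRZ (- q ^ 2) (n * n))
      * usum (fun n => powerRZ (- q ^ 2) (n * n))) by ring.
  rewrite (usum_ext _ (fun p => if Z.even (fst p + snd p)
    then powerRZ q (fst p * fst p) * powerRZ (- q) (snd p * snd p) else 0)).
  - rewrite (usum_same_parity
      (fun p => powerRZ q (fst p * fst p) * powerRZ (- q) (snd p * snd p))) by trivial.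
    assert (Hq2 := base_opp _ (base_sqr _ Hq)).
    rewrite usum_mult; try now apply phi_summable.
    apply usum_ext. intros [m n]. simpl fst; simpl snd.
    rewrite !powerRZ_opp, !powerRZ_sqr.
    transitivity (sgZ ((m - n) * (m - n)) * powerRZ q (2 * (m * m) + 2 * (n * n))).
    + rewrite <- (Rmult_assoc (powerRZ _ _)), (Rmult_comm (powerRZ _ _)), Rmult_assoc,
        <- powerRZ_add by trivial. do 2 f_equal. ring.
    + rewrite powerRZ_add by trivial.
      replace (sgZ ((m - n) * (m - n))) with (sgZ (m * m) * sgZ (n * n)); [ring|].
      rewrite <- sgZ_plus. sign_parity. now destruct (Z.even m), (Z.even n).
  - intros [a b]. simpl. rewrite !powerRZ_opp. sign_parity.
    destruct (Z.even a), (Z.even b); simpl; field.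
Qed.

(** Adding the two double sums doubles the pairs of equal parity and kills the others. *)
Lemma phi_sqr_add q : base q -> phi q ^ 2 + phi (- q) ^ 2 = 2 * phi (q ^ 2) ^ 2.
Proof.
  intros Hq. assert (Hq0 := base_neq q Hq). assert (Hq2 := base_sqr _ Hq).
  assert (Hq' := base_opp _ Hq).
  assert (Hs := summable_prod _ _ (phi_summable q Hq) (phi_summable q Hq)).
  assert (Hs' := summable_prod _ _ (phi_summable _ Hq') (phi_summable _ Hq')).
  assert (E : forall x : R, x ^ 2 = x * x) by (intros; ring).
  rewrite !(E (phi _)). unfold phi.
  rewrite !usum_mult by now apply phi_summable.
  rewrite <- usum_plus by trivial.
  rewrite (usum_ext _ (fun p => 2 * if Z.even (fst p + snd p)
    then powerRZ q (fst p * fst p) * powerRZ q (snd p * snd p) else 0)).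
  - rewrite usum_scal.
    + f_equal. rewrite (usum_same_parity
        (fun p => powerRZ q (fst p * fst p) * powerRZ q (snd p * snd p))) by trivial.
      apply usum_ext. intros [m n]. simpl fst; simpl snd.
      rewrite !powerRZ_sqr, <- !powerRZ_add by trivial. f_equal. ring.
    + apply (summable_le _ (fun p : Z * Z =>
        Rabs (powerRZ q (fst p * fst p) * powerRZ q (snd p * snd p)))).
      * intros p. destruct Z.even; [lra|]. rewrite Rabs_R0. apply Rabs_pos.
      * destruct Hs as (M & HM). exists M. intros l Hl.
        erewrite lsum_ext; [apply (HM l Hl)|]. intros; apply Rabs_Rabsolu.
  - intros [a b]. simpl. rewrite !powerRZ_opp. sign_parity.
    destruct (Z.even a), (Z.even b); simpl; ring.
Qed.

(** With n = a - b, and a + b equal to 2 m or 1 - 2 m according to its parity, the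
    exponent (2 a^2 - a) + (2 b^2 - b) becomes n^2 + 2 (2 m^2 - m). *)
Lemma psi_sqr q : base q -> psi q ^ 2 = phi q * psi (q ^ 2).
Proof.
  intros Hq. assert (Hq0 := base_neq q Hq). assert (Hq2 := base_sqr _ Hq).
  replace (psi q ^ 2) with (psi q * psi q) by ring. unfold psi, phi.
  rewrite !usum_mult by now (apply psi_summable || apply phi_summable).
  set (e := fun p : Z * Z => let (n, m) := p in let h := (n / 2)%Z in
    if Z.even n then (m + h, m - h)%Z else (h + 1 - m, - h - m)%Z).
  set (d := fun p : Z * Z => let (a, b) := p in
    (a - b, if Z.even (a + b) then (a + b) / 2 else (1 - a - b) / 2)%Z).
  assert (Hpar : forall n : Z, (exists h, (n = 2 * h /\ n / 2 = h)%Z /\ Z.even n = true) \/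
     (exists h, (n = 2 * h + 1 /\ n / 2 = h)%Z /\ Z.even n = false)).
  { intros n. destruct (Z.even n) eqn:He.
    - left. apply Z.even_spec in He as (h & ->). exists h. rewrite Z.mul_comm, Z.div_mul; lia.
    - right. assert (Ho : Z.odd n = true) by (rewrite <- Z.negb_even, He; trivial).
      apply Z.odd_spec in Ho as (h & ->). exists h.
      rewrite Z.mul_comm, Z.div_add_l; [|lia]. simpl. change (1/2)%Z with 0%Z. lia. }
  rewrite (usum_bij e d).
  - apply usum_ext. intros [n m]. unfold e.
    rewrite powerRZ_sqr.
    destruct (Hpar n) as [(h & (Hn & ->) & ->)|(h & (Hn & ->) & ->)]; simpl fst; simpl snd;
    rewrite <- !powerRZ_add by trivial; subst n; f_equal; ring.
  - intros [n m]. unfold e, d.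
    destruct (Hpar n) as [(h & (Hn & ->) & ->)|(h & (Hn & ->) & ->)].
    + replace (m + h + (m - h))%Z with (m * 2)%Z by ring.
      rewrite Z.even_mul, Z.div_mul by lia. simpl. rewrite Bool.orb_true_r. f_equal; lia.
    + replace (h + 1 - m + (- h - m))%Z with (1 + 2 * (- m))%Z by ring.
      rewrite Z.even_add_mul_2. simpl Z.even. cbv iota.
      replace (1 - (h + 1 - m) - (- h - m))%Z with (m * 2)%Z by ring.
      rewrite Z.div_mul by lia. f_equal; lia.
  - intros [a b]. unfold e, d.
    destruct (Hpar (a + b)%Z) as [(h & (Hn & ->) & ->)|(h & (Hn & ->) & ->)].
    + replace (a - b)%Z with ((h - b) * 2)%Z by lia.
      rewrite Z.even_mul, Z.div_mul by lia. simpl. rewrite Bool.orb_true_r. f_equal; lia.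
    + replace (a - b)%Z with (1 + 2 * (h - b))%Z by lia.
      rewrite Z.even_add_mul_2. simpl Z.even. cbv iota.
      replace (1 + 2 * (h - b))%Z with ((h - b) * 2 + 1)%Z by ring.
      rewrite Z.div_add_l by lia. change (1 / 2)%Z with 0%Z.
      replace (1 - a - b)%Z with ((- h) * 2)%Z by lia.
      rewrite Z.div_mul by lia. f_equal; lia.
  - apply (summable_prod _ _ (psi_summable q Hq) (psi_summable q Hq)).
Qed.

(** Only the even squares 4 m^2 survive. *)
Lemma phi_add_opp q : base q -> phi q + phi (- q) = 2 * phi (q ^ 4).
Proof.
  intros Hq. assert (Hq4 := base_sqr _ (base_sqr _ Hq)).
  replace ((q ^ 2) ^ 2) with (q ^ 4) in Hq4 by ring.
  assert (Hs := phi_summable q Hq). assert (Hs' := phi_summable _ (base_opp _ Hq)).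
  unfold phi. rewrite <- usum_plus by trivial.
  rewrite (usum_embed (fun n => 2 * n)%Z).
  - rewrite <- usum_scal by now apply phi_summable. apply usum_ext. intros n.
    replace (q ^ 4) with ((q ^ 2) ^ 2) by ring. rewrite !powerRZ_sqr, powerRZ_opp.
    rewrite sgZ_even. replace (2 * n * (2 * n))%Z with (2 * (2 * (n * n)))%Z by ring.
    rewrite Z.even_mul. simpl Z.even. simpl orb. cbv iota. ring.
  - intros; lia.
  - intros n Hn. rewrite powerRZ_opp. sign_parity. destruct (Z.even n) eqn:He.
    + exfalso. apply Z.even_spec in He as (m & ->). now apply (Hn m).
    + simpl. ring.
  - now apply summable_plus.
Qed.

(** The odd squares are 4 j (j + 1) + 1. *)
Lemma phi_sub_opp q : base q ->
  phi q - phi (- q) = 2 * q * usum (fun j : Z => powerRZ q (4 * (j * j + j))).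
Proof.
  intros Hq. assert (Hq0 := base_neq q Hq).
  assert (Hs := phi_summable q Hq). assert (Hs' := phi_summable _ (base_opp _ Hq)).
  assert (Hsum : summable (fun n => powerRZ q (n * n) + (-1) * powerRZ (- q) (n * n)))
    by (apply summable_plus; trivial; now apply summable_scal).
  unfold phi. unfold Rminus.
  replace (- usum (fun n => powerRZ (- q) (n * n))) with
    ((-1) * usum (fun n => powerRZ (- q) (n * n))) by ring.
  rewrite <- usum_scal, <- usum_plus; trivial; [|now apply summable_scal].
  rewrite (usum_embed (fun n => 2 * n + 1)%Z); trivial.
  - assert (E : forall j, powerRZ q ((2 * j + 1) * (2 * j + 1))
        + -1 * powerRZ (- q) ((2 * j + 1) * (2 * j + 1))
        = 2 * q * powerRZ q (4 * (j * j + j))).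
    { intros j. rewrite powerRZ_opp. sign_parity.
      replace ((2 * j + 1) * (2 * j + 1))%Z with (1 + 4 * (j * j + j))%Z by ring.
      rewrite powerRZ_add by trivial. simpl. ring. }
    rewrite (usum_ext _ _ E), usum_scal; trivial.
    apply (summable_comp (fun n => 2 * n + 1)%Z) in Hsum; [|intros; lia].
    apply (summable_scal (/ (2 * q))) in Hsum. revert Hsum. apply summable_ext.
    intros j. rewrite E. field. trivial.
  - intros; lia.
  - intros n Hn. rewrite powerRZ_opp. sign_parity. destruct (Z.even n) eqn:He.
    + simpl. ring.
    + exfalso. assert (Ho : Z.odd n = true) by (rewrite <- Z.negb_even, He; trivial).
      apply Z.odd_spec in Ho as (m & ->). now apply (Hn m).
Qed.

(** * The theta series of x^2 + 2 y^2 *)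

Definition lam_term (q : R) (n : Z) : R := powerRZ q n / (1 + powerRZ q (4 * n)).

(** The theta series of x^2 + 2 y^2, as a bilateral sum; the factor 2 makes its
    constant term 1. *)
Definition lam (q : R) : R := 2 * usum (lam_term q).

Lemma powerRZ_4_pos q n : q <> 0 -> 0 < powerRZ q (4 * n).
Proof.
  intros Hq. replace (4 * n)%Z with (2 * (2 * n))%Z by ring.
  rewrite <- !powerRZ_sqr. apply powerRZ_lt. apply pow2_gt_0; now apply pow_nonzero.
Qed.

Lemma lam_term_bound q n : base q -> Rabs (lam_term q n) <= 1 * Rabs q ^ Z.abs_nat n.
Proof.
  intros Hq. assert (Hq0 := base_neq q Hq). rewrite Rmult_1_l.
  assert (H4 := powerRZ_4_pos q n Hq0). assert (H4' := powerRZ_4_pos q (- n) Hq0).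
  assert (Hb : forall x y, 0 < y -> Rabs (x / (1 + y)) <= Rabs x).
  { intros x y Hy. unfold Rdiv. rewrite Rabs_mult.
    rewrite <- (Rmult_1_r (Rabs x)) at 2. apply Rmult_le_compat_l; [apply Rabs_pos|].
    rewrite Rabs_right by (left; apply Rinv_0_lt_compat; lra).
    rewrite <- Rinv_1. apply Rinv_le_contravar; lra. }
  unfold lam_term. destruct (Z_le_gt_dec 0 n) as [H|H].
  - eapply Rle_trans; [now apply Hb|]. apply powerRZ_abs_le; trivial. lia.
  (* for negative n, numerator and denominator are divided by q^(4n) *)
  - replace (powerRZ q n / (1 + powerRZ q (4 * n))) with
      (powerRZ q (- (3 * n)) / (1 + powerRZ q (4 * - n))).
    + eapply Rle_trans; [now apply Hb|]. apply powerRZ_abs_le; trivial. lia.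
    + replace (- (3 * n))%Z with (n + 4 * - n)%Z by ring.
      rewrite powerRZ_add by trivial.
      replace (4 * - n)%Z with (- (4 * n))%Z by ring. rewrite powerRZ_neg'.
      field. lra.
Qed.

Lemma lam_term_summable q : base q -> summable (lam_term q).
Proof.
  intros H. apply (summable_Z_geom _ 1 (Rabs q)); [lra|unfold base in H; lra|].
  intros; now apply lam_term_bound.
Qed.

(** The even terms are those of base q^2, the odd ones cancel. *)
Lemma lam_add_opp q : base q -> lam q + lam (- q) = 2 * lam (q ^ 2).
Proof.
  intros Hq. assert (Hq2 := base_sqr _ Hq). assert (Hq' := base_opp _ Hq).
  unfold lam. rewrite <- Rmult_plus_distr_l. f_equal.
  rewrite <- usum_plus by now apply lam_term_summable.
  rewrite (usum_embed (fun n => 2 * n)%Z).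
  - rewrite <- usum_scal by now apply lam_term_summable. apply usum_ext. intros n.
    unfold lam_term. rewrite !powerRZ_sqr, !powerRZ_opp. sign_parity.
    replace (2 * (4 * n))%Z with (4 * (2 * n))%Z by ring. simpl orb. cbv iota.
    rewrite !Rmult_1_l. lra.
  - intros; lia.
  - intros n Hn. unfold lam_term. rewrite !powerRZ_opp. sign_parity.
    destruct (Z.even n) eqn:He.
    + exfalso. apply Z.even_spec in He as (m & ->). now apply (Hn m).
    + simpl orb. cbv iota. rewrite Rmult_1_l.
      assert (H4 := powerRZ_4_pos q n (base_neq _ Hq)). field. lra.
  - apply summable_plus; now apply lam_term_summable.
Qed.

(** After extraction of q^m, the part of degree m = k + n of the double series
    [psi (- q)] times [lam_term q]. *)
Definition diag_term (q : R) (m k : Z) : R :=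
  sgZ k * powerRZ q (2 * k * k - 2 * k) / (1 + powerRZ q (4 * (m - k))).

Lemma diag_term_summable q m : base q -> summable (diag_term q m).
Proof.
  intros Hq. assert (Hq0 := base_neq q Hq).
  apply (summable_Z_geom _ (/ Rabs q) (Rabs q)).
  - left. apply Rinv_0_lt_compat, Hq.
  - unfold base in Hq; lra.
  - intros k. assert (H4 := powerRZ_4_pos q (m - k) Hq0).
    unfold diag_term, Rdiv. rewrite !Rabs_mult, sgZ_abs, Rmult_1_l.
    replace (2 * k * k - 2 * k)%Z with (-1 + (2 * k * k - 2 * k + 1))%Z by ring.
    rewrite powerRZ_add by trivial. rewrite Rabs_mult, Rmult_assoc.
    replace (Rabs (powerRZ q (-1))) with (/ Rabs q)
      by (simpl; rewrite Rmult_1_r, Rabs_inv; trivial).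
    apply Rmult_le_compat_l; [left; apply Rinv_0_lt_compat, Hq|].
    rewrite <- (Rmult_1_r (_ ^ _)). apply Rmult_le_compat; try apply Rabs_pos.
    + apply powerRZ_abs_le; trivial. destruct (Z_le_gt_dec k 0); nia.
    + rewrite Rabs_right by (left; apply Rinv_0_lt_compat; lra).
      rewrite <- Rinv_1. apply Rinv_le_contravar; lra.
Qed.

(** Shifting k by one multiplies the numerator by q^(4k), which is
    q^(4k) (1 + q^(4(m-k))) - q^(4m); the first part leaves the alternating sum of
    q^(2k^2+2k), zero by the symmetry k -> - 1 - k. *)
Lemma diag_succ q m : base q ->
  usum (diag_term q (m + 1)) = powerRZ q (4 * m) * usum (diag_term q m).
Proof.
  intros Hq. assert (Hq0 := base_neq q Hq).
  set (g := fun k : Z => sgZ k * powerRZ q (2 * k * k + 2 * k)).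
  assert (Hd := diag_term_summable q m Hq).
  assert (Hd' := summable_scal (powerRZ q (4 * m)) _ Hd).
  assert (E : forall k, diag_term q (m + 1) (k + 1)
      = powerRZ q (4 * m) * diag_term q m k + (-1) * g k).
  { intros k. unfold diag_term, g. rewrite sgZ_plus.
    replace (m + 1 - (k + 1))%Z with (m - k)%Z by ring.
    replace (2 * (k + 1) * (k + 1) - 2 * (k + 1))%Z with (2 * k * k - 2 * k + 4 * k)%Z by ring.
    replace (2 * k * k + 2 * k)%Z with (2 * k * k - 2 * k + 4 * k)%Z by ring.
    assert (H4 := powerRZ_4_pos q (m - k) Hq0).
    replace (4 * m)%Z with (4 * (m - k) + 4 * k)%Z by ring.
    rewrite !powerRZ_add by trivial. replace (sgZ 1) with (-1) by (unfold sgZ; simpl; ring).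
    field. lra. }
  assert (Hs : summable g).
  { assert (H := diag_term_summable q (m + 1) Hq).
    apply (summable_comp (fun k => k + 1)%Z) in H; [|intros; lia].
    apply (summable_scal (-1)) in H.
    assert (H' := summable_plus _ _ H Hd').
    revert H'. apply summable_ext. intros k. cbv beta. rewrite E. ring. }
  assert (Hg : usum g = 0).
  { assert (H : usum g = -1 * usum g); [|lra].
    rewrite (usum_bij (fun k => -1 - k)%Z (fun k => -1 - k)%Z g) at 1 by (trivial; intros; lia).
    rewrite <- usum_scal by trivial. apply usum_ext. intros k. unfold g.
    replace (2 * (-1 - k) * (-1 - k) + 2 * (-1 - k))%Z with (2 * k * k + 2 * k)%Z by ring.
    sign_parity. destruct (Z.even k); simpl; ring. }
  rewrite (usum_bij (fun k => k + 1)%Z (fun k => k - 1)%Z (diag_term q (m + 1)))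
    by (try (intros; lia); now apply diag_term_summable).
  rewrite (usum_ext _ _ E), usum_plus by (trivial; now apply summable_scal).
  rewrite !usum_scal by trivial. rewrite Hg. ring.
Qed.

Lemma diag_eval q m : base q ->
  usum (diag_term q m) = powerRZ q (2 * m * m - 2 * m) * usum (diag_term q 0).
Proof.
  intros Hq. assert (Hq0 := base_neq q Hq).
  assert (E : forall m, powerRZ q (2 * (m + 1) * (m + 1) - 2 * (m + 1))
    = powerRZ q (4 * m) * powerRZ q (2 * m * m - 2 * m)).
  { intros n. rewrite <- powerRZ_add by trivial. f_equal. ring. }
  apply Z.bi_induction with (z := m).
  - intros x y ->. reflexivity.
  - simpl. ring.
  - intros n. unfold Z.succ. rewrite E, diag_succ by trivial.
    assert (H4 := powerRZ_4_pos q n Hq0). rewrite Rmult_assoc. split; intros H.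
    + now rewrite H.
    + apply Rmult_eq_reg_l in H; trivial. lra.
Qed.

(** Ordering the double sum of the product by the total degree m, the coefficient of
    q^m is the sum evaluated in [diag_eval]. *)
Lemma psi_mul_lam q : base q ->
  psi (- q) * lam q = 2 * usum (diag_term q 0) * psi q.
Proof.
  intros Hq. assert (Hq0 := base_neq q Hq). assert (Hq' := base_opp _ Hq).
  assert (Hl := lam_term_summable q Hq). assert (Hp := psi_summable _ Hq').
  unfold lam. rewrite <- Rmult_assoc, (Rmult_comm _ 2), !Rmult_assoc. f_equal.
  unfold psi. rewrite usum_mult by trivial.
  assert (Hs := summable_prod _ _ Hp Hl).
  set (e := fun p : Z * Z => (snd p, fst p - snd p)%Z).
  assert (He : forall x y, e x = e y -> x = y).
  { intros [a b] [c d]; unfold e; simpl. intros H; injection H; intros; f_equal; lia. }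
  rewrite (usum_bij e (fun p => (fst p + snd p, fst p)%Z)); trivial.
  - rewrite usum_fubini by exact (summable_comp e _ He Hs).
    rewrite <- usum_scal by now apply psi_summable.
    apply usum_ext. intros m. unfold e; simpl fst; simpl snd.
    rewrite (usum_ext _ (fun k => powerRZ q m * diag_term q m k)).
    + rewrite usum_scal by now apply diag_term_summable. rewrite diag_eval by trivial.
      replace (2 * m * m - m)%Z with (m + (2 * m * m - 2 * m))%Z by ring.
      rewrite powerRZ_add by trivial. ring.
    + intros k. unfold lam_term, diag_term. rewrite powerRZ_opp.
      replace (sgZ (2 * k * k - k)) with (sgZ k)
        by (sign_parity; now destruct (Z.even k)).
      assert (H4 := powerRZ_4_pos q (m - k) Hq0).
      unfold Rdiv. rewrite <- !Rmult_assoc. f_equal.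
      rewrite Rmult_assoc, (Rmult_comm (powerRZ q m)), Rmult_assoc.
      rewrite <- !powerRZ_add by trivial. do 2 f_equal. ring.
  - intros [a b]. unfold e; simpl; f_equal; ring.
  - intros [a b]. unfold e; simpl; f_equal; ring.
Qed.

Lemma diag_opp q : usum (diag_term (- q) 0) = usum (diag_term q 0).
Proof.
  apply usum_ext. intros k. unfold diag_term. rewrite !powerRZ_opp. sign_parity.
  simpl orb. simpl Bool.eqb. cbv iota. now rewrite !Rmult_1_l.
Qed.

Lemma usum_Z_near_1 (f : Z -> R) q : base q ->
  (forall n, Rabs (f n) <= 1 * Rabs q ^ Z.abs_nat n) ->
  Rabs (usum f - f 0%Z) <= 2 * Rabs q / (1 - Rabs q).
Proof.
  intros Hq Hf. assert (H := usum_Z_near f 1 (Rabs q)).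
  rewrite Rmult_1_r in H. apply H; trivial; unfold base in Hq; lra.
Qed.

Lemma phi_near q : base q -> Rabs (phi q - 1) <= 2 * Rabs q / (1 - Rabs q).
Proof.
  intros Hq. apply (usum_Z_near_1 (fun n => powerRZ q (n * n)) q Hq).
  intros; now apply phi_bound.
Qed.

Lemma lam_near q : base q -> Rabs (lam q - 1) <= 2 * (2 * Rabs q / (1 - Rabs q)).
Proof.
  intros Hq. assert (H := usum_Z_near_1 (lam_term q) q Hq (fun n => lam_term_bound q n Hq)).
  unfold lam. replace (lam_term q 0) with (/ 2) in H by (unfold lam_term; simpl; field).
  replace (2 * usum (lam_term q) - 1) with (2 * (usum (lam_term q) - / 2)) by field.
  rewrite Rabs_mult, (Rabs_right 2) by lra. lra.
Qed.

(** * Limits along q, q^2, q^4, ... *)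

Definition tower (q : R) (n : nat) : R := q ^ (2 ^ n).

Lemma tower_S q n : tower q (S n) = tower q n ^ 2.
Proof. unfold tower. rewrite <- pow_mult. f_equal. simpl. lia. Qed.

Lemma tower_range q n : 0 < q < 1 -> 0 < tower q n < 1.
Proof.
  intros Hq. induction n as [|n IH].
  - unfold tower; simpl. lra.
  - rewrite tower_S. simpl. nra.
Qed.

Lemma tower_cv0 q : 0 < q < 1 -> is_lim_seq (tower q) 0.
Proof.
  intros Hq. assert (Hp : forall n, (n <= 2 ^ n)%nat).
  { intros n. induction n; simpl; [lia|].
    assert (1 <= 2 ^ n)%nat by (clear; induction n; simpl; lia). lia. }
  apply is_lim_seq_le_le with (u := fun _ => 0) (w := fun n => q ^ n).
  - intros n. split; [left; now apply tower_range|].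
    now apply pow_le_pow.
  - apply is_lim_seq_const.
  - apply is_lim_seq_geom. rewrite Rabs_right; lra.
Qed.

(** The sign s serves for the values of a theta series at - q^(2^n). *)
Lemma near_tower_cv (f : R -> R) c s q : 0 < q < 1 -> Rabs s = 1 ->
  (forall x, base x -> Rabs (f x - 1) <= c * (2 * Rabs x / (1 - Rabs x))) ->
  is_lim_seq (fun n => f (s * tower q n)) 1.
Proof.
  intros Hq Hs Hf.
  assert (Hl : is_lim_seq (fun n => c * (2 * tower q n / (1 - tower q n))) 0).
  { replace (Finite 0) with (Finite (c * (2 * 0 / (1 - 0)))) by (f_equal; field).
    apply (is_lim_seq_scal_l (fun n => 2 * tower q n / (1 - tower q n)) c (2 * 0 / (1 - 0))).
    apply is_lim_seq_div'; [|apply is_lim_seq_minus'|lra].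
    - apply (is_lim_seq_scal_l (tower q) 2 0). now apply tower_cv0.
    - apply is_lim_seq_const.
    - now apply tower_cv0. }
  apply is_lim_seq_le_le with (u := fun n => 1 - c * (2 * tower q n / (1 - tower q n)))
    (w := fun n => 1 + c * (2 * tower q n / (1 - tower q n))).
  - intros n. assert (Ht := tower_range q n Hq).
    assert (Hx : Rabs (s * tower q n) = tower q n)
      by (rewrite Rabs_mult, Hs, Rmult_1_l, Rabs_right; lra).
    assert (H := Hf (s * tower q n)). rewrite Hx in H.
    apply Rabs_le_between in H; [lra|]. unfold base. rewrite Hx. lra.
  - replace (Finite 1) with (Finite (1 - 0)) by (f_equal; ring).
    apply is_lim_seq_minus'; trivial. apply is_lim_seq_const.
  - replace (Finite 1) with (Finite (1 + 0)) by (f_equal; ring).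
    apply is_lim_seq_plus'; trivial. apply is_lim_seq_const.
Qed.

Lemma phi_tower q : 0 < q < 1 -> is_lim_seq (fun n => phi (tower q n)) 1.
Proof.
  intros Hq. apply is_lim_seq_ext with (fun n => phi (1 * tower q n)).
  - intros; now rewrite Rmult_1_l.
  - apply (near_tower_cv phi 1 1 q Hq Rabs_R1). intros x Hx.
    rewrite Rmult_1_l. now apply phi_near.
Qed.

Lemma phi_opp_tower q : 0 < q < 1 -> is_lim_seq (fun n => phi (- tower q n)) 1.
Proof.
  intros Hq. apply is_lim_seq_ext with (fun n => phi (- (1) * tower q n)).
  - intros; f_equal; ring.
  - apply (near_tower_cv phi 1 (- (1)) q Hq); [rewrite Rabs_Ropp; apply Rabs_R1|].
    intros x Hx. rewrite Rmult_1_l. now apply phi_near.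
Qed.

Lemma lam_tower q : 0 < q < 1 -> is_lim_seq (fun n => lam (tower q n)) 1.
Proof.
  intros Hq. apply is_lim_seq_ext with (fun n => lam (1 * tower q n)).
  - intros; now rewrite Rmult_1_l.
  - apply (near_tower_cv lam 2 1 q Hq Rabs_R1). intros x Hx. now apply lam_near.
Qed.

Lemma phi_pos q : 0 < q < 1 -> 0 < phi q.
Proof.
  intros Hq. apply Rlt_le_trans with (powerRZ q (0 * 0)); [simpl; lra|].
  apply (usum_ge_term (fun n => powerRZ q (n * n)) 0%Z).
  - now apply phi_summable, base_pos.
  - intros j. apply powerRZ_le. lra.
Qed.

(** A zero at q would propagate to q^2, q^4, ... through [phi_mul_opp]. *)
Lemma phi_opp_pos q : 0 < q < 1 -> 0 < phi (- q).
Proof.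
  intros Hq.
  assert (H0 : forall x, 0 < x < 1 -> 0 <= phi (- x)).
  { intros x Hx. assert (H := phi_mul_opp x (base_pos _ Hx)). assert (Hp := phi_pos x Hx).
    assert (0 <= phi (- x ^ 2) ^ 2) by apply pow2_ge_0.
    apply Rnot_lt_le. intros Hn. nra. }
  destruct (H0 q Hq) as [|Hz]; trivial. exfalso.
  assert (Hall : forall n, phi (- tower q n) = 0).
  { induction n as [|n IH].
    - unfold tower; simpl. now rewrite Rmult_1_r.
    - rewrite tower_S. assert (H := phi_mul_opp _ (base_pos _ (tower_range q n Hq))).
      rewrite IH, Rmult_0_r in H.
      destruct (Req_dec (phi (- tower q n ^ 2)) 0) as [|Hne]; trivial.
      exfalso. apply (pow_nonzero _ 2) in Hne. lra. }
  assert (Hl := phi_opp_tower q Hq).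
  apply (is_lim_seq_ext _ (fun _ => 0)) in Hl; trivial.
  assert (Hc := is_lim_seq_const 0).
  assert (E := is_lim_seq_unique _ _ Hl). rewrite (is_lim_seq_unique _ _ Hc) in E.
  injection E. lra.
Qed.

Lemma psi_pos q : 0 < q < 1 -> 0 < psi q.
Proof.
  intros Hq. apply Rlt_le_trans with (powerRZ q (2 * 0 * 0 - 0)); [simpl; lra|].
  apply (usum_ge_term (fun n => powerRZ q (2 * n * n - n)) 0%Z).
  - now apply psi_summable, base_pos.
  - intros j. apply powerRZ_le. lra.
Qed.

(** [psi_mul_lam] at q and at - q carries the same unknown factor, so the ratio of the two
    values of [lam] is that of the squares of [psi], which [psi_sqr] turns into [phi]. *)
Lemma lam_opp q : 0 < q < 1 -> lam (- q) * phi q = lam q * phi (- q).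
Proof.
  intros Hq. assert (Hb := base_pos q Hq). assert (Hb' := base_opp _ Hb).
  assert (H1 := psi_mul_lam q Hb). assert (H2 := psi_mul_lam (- q) Hb').
  rewrite Ropp_involutive, diag_opp in H2.
  assert (S1 := psi_sqr q Hb). assert (S2 := psi_sqr (- q) Hb').
  replace ((- q) ^ 2) with (q ^ 2) in S2 by ring.
  assert (Hp : 0 < psi (q ^ 2)) by (apply psi_pos; simpl; nra).
  apply (Rmult_eq_reg_r (psi (q ^ 2))); [|lra].
  rewrite !Rmult_assoc, <- S1, <- S2.
  replace (lam (- q) * psi q ^ 2) with (psi q * lam (- q) * psi q) by ring.
  replace (lam q * psi (- q) ^ 2) with (psi (- q) * lam q * psi (- q)) by ring.
  rewrite H1, H2. ring.
Qed.

Lemma lam_ratio_sqr q : 0 < q < 1 ->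
  lam q * (phi (q ^ 2) * phi (q ^ 4)) = lam (q ^ 2) * (phi q * phi (q ^ 2)).
Proof.
  intros Hq. assert (Hb := base_pos q Hq).
  assert (H1 := lam_opp q Hq). assert (H2 := lam_add_opp q Hb).
  assert (H3 := phi_add_opp q Hb).
  replace (lam (q ^ 2)) with ((lam q + lam (- q)) / 2) by lra.
  replace (phi (q ^ 4)) with ((phi q + phi (- q)) / 2) by lra.
  replace (lam q * (phi (q ^ 2) * ((phi q + phi (- q)) / 2)))
    with (phi (q ^ 2) / 2 * (lam q * phi q + lam q * phi (- q))) by field.
  rewrite <- H1. field.
Qed.

(** The ratio of both sides is unchanged under q -> q^2 and tends to 1 at q = 0. *)
Theorem lam_eq q : 0 < q < 1 -> lam q = phi q * phi (q ^ 2).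
Proof.
  intros Hq.
  assert (Hp : forall n, 0 < phi (tower q n)) by (intros; now apply phi_pos, tower_range).
  set (r := fun n => lam (tower q n) / (phi (tower q n) * phi (tower q (S n)))).
  assert (Hr : forall n, r n = r 0%nat).
  { induction n as [|n IH]; trivial. rewrite <- IH. unfold r.
    assert (H := lam_ratio_sqr _ (tower_range q n Hq)).
    replace (tower q n ^ 4) with (tower q (S (S n))) in H
      by (rewrite !tower_S; ring).
    rewrite <- tower_S in H.
    assert (H0 := Hp n). assert (H1 := Hp (S n)). assert (H2 := Hp (S (S n))).
    apply (Rmult_eq_reg_r (phi (tower q n) * phi (tower q (S n)) * phi (tower q (S (S n)))));
      [|apply Rgt_not_eq; repeat apply Rmult_lt_0_compat; trivial].
    field_simplify; [|repeat split; lra|repeat split; lra]. nra. }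
  assert (Hl : is_lim_seq r (1 / (1 * 1))).
  { apply is_lim_seq_div'; [now apply lam_tower| |lra].
    apply is_lim_seq_mult'; [now apply phi_tower|].
    apply (is_lim_seq_incr_1 (fun n => phi (tower q n))). now apply phi_tower. }
  apply (is_lim_seq_ext _ (fun _ => r 0%nat)) in Hl; [|exact Hr].
  assert (E := is_lim_seq_unique _ _ Hl). rewrite Lim_seq_const in E.
  injection E. unfold r. rewrite tower_S.
  replace (tower q 0) with q by (unfold tower; simpl; ring).
  assert (H0 := Hp 0%nat). assert (H1 := Hp 1%nat). rewrite tower_S in H1.
  replace (tower q 0) with q in H0, H1 by (unfold tower; simpl; ring).
  intros Hx. apply (Rmult_eq_reg_r (/ (phi q * phi (q ^ 2)))).
  - unfold Rdiv in Hx. rewrite Hx. field. lra.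
  - apply Rinv_neq_0_compat. apply Rgt_not_eq. now apply Rmult_lt_0_compat.
Qed.

(** * The Lambert series *)

Definition chi (n : nat) : R := (-1) ^ (n / 2).

Lemma chi_abs n : Rabs (chi n) = 1.
Proof. apply pow_1_abs. Qed.

Lemma chi_SS n : chi (S (S n)) = - chi n.
Proof.
  unfold chi. replace (S (S n)) with (n + 1 * 2)%nat by lia.
  rewrite Nat.div_add by lia. rewrite pow_add. simpl. ring.
Qed.

Lemma chi_odd_summable p : 0 < p < 1 -> summable (fun n => chi n * p ^ (2 * n + 1)).
Proof.
  intros Hp. apply (summable_nat_geom _ 1 p); try lra. intros n.
  rewrite Rabs_mult, chi_abs, !Rmult_1_l, Rabs_right by (apply Rle_ge, pow_le; lra).
  apply pow_le_pow; trivial. lia.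
Qed.

(** chi changes sign under n -> n + 2, so the series is geometric of ratio - p^4. *)
Lemma chi_odd_sum p : 0 < p < 1 ->
  usum (fun n => chi n * p ^ (2 * n + 1)) = (p + p ^ 3) / (1 + p ^ 4).
Proof.
  intros Hp. assert (Hs := chi_odd_summable p Hp).
  assert (Hse : ex_series (fun n => chi n * p ^ (2 * n + 1)))
    by (eexists; now apply usum_nat_is_series).
  rewrite usum_nat_Series by trivial. set (s := Series _).
  assert (E : s = p + (p ^ 3 + (- p ^ 4) * s)).
  { unfold s at 1. rewrite Series_incr_1 by trivial.
    rewrite Series_incr_1 by now apply (ex_series_incr_1 (fun n => chi n * p ^ (2 * n + 1))).
    f_equal; [unfold chi; simpl; ring|f_equal; [unfold chi; simpl; ring|]].
    unfold s. rewrite <- Series_scal_l. apply Series_ext. intros n. rewrite chi_SS.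
    replace (2 * S (S n) + 1)%nat with (4 + (2 * n + 1))%nat by lia.
    rewrite pow_add. ring. }
  assert (0 < p ^ 4) by (apply pow_lt; lra).
  apply (Rmult_eq_reg_r (1 + p ^ 4)); [|lra].
  replace (s * (1 + p ^ 4)) with (s - (- p ^ 4) * s) by ring. rewrite E at 1. field. lra.
Qed.

Lemma lam_term_fold q r : 0 < q < 1 ->
  lam_term q (Z.of_nat (S r)) + lam_term q (- Z.of_nat (S r))
  = (q ^ S r + (q ^ S r) ^ 3) / (1 + (q ^ S r) ^ 4).
Proof.
  intros Hq. unfold lam_term. set (p := q ^ S r).
  assert (Hp : 0 < p) by (apply pow_lt; lra).
  assert (E4 : powerRZ q (4 * Z.of_nat (S r)) = p ^ 4).
  { replace (4 * Z.of_nat (S r))%Z with (Z.of_nat (S r * 4)) by lia.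
    rewrite <- pow_powerRZ. apply pow_mult. }
  replace (4 * - Z.of_nat (S r))%Z with (- (4 * Z.of_nat (S r)))%Z by ring.
  rewrite !powerRZ_neg', E4, <- pow_powerRZ. fold p.
  assert (0 < p ^ 4) by now apply pow_lt.
  field. repeat split; lra.
Qed.

Lemma double_lambert_summable q : 0 < q < 1 ->
  summable (fun x : nat * nat => chi (fst x) * q ^ ((2 * fst x + 1) * S (snd x))).
Proof.
  intros Hq. assert (Hg : summable (fun n => q ^ n)).
  { apply (summable_nat_geom _ 1 q); try lra. intros n.
    rewrite Rabs_right by (apply Rle_ge, pow_le; lra). lra. }
  apply summable_le with (2 := summable_prod _ _ Hg Hg).
  intros [n r]. simpl fst; simpl snd.
  rewrite Rabs_mult, chi_abs, Rmult_1_l, Rabs_right by (apply Rle_ge, pow_le; lra).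
  rewrite <- pow_add. apply pow_le_pow; trivial. nia.
Qed.

(** Both sides are the double series of chi(n) q^((2n+1)(r+1)), summed first over n on
    one side and first over r on the other. *)
Lemma lam_lambert q : 0 < q < 1 ->
  is_series (fun n => 2 * chi n * (q ^ (2 * n + 1) / (1 - q ^ (2 * n + 1)))) (lam q - 1).
Proof.
  intros Hq. assert (Hs := double_lambert_summable q Hq).
  assert (Hpow := fun n => pow_range q n Hq).
  assert (Hrow : forall n, usum (fun r => chi n * q ^ ((2 * n + 1) * S r))
    = chi n * (q ^ (2 * n + 1) / (1 - q ^ (2 * n + 1)))).
  { intros n. specialize (Hpow (2 * n)%nat).
    replace (S (2 * n)) with (2 * n + 1)%nat in Hpow by lia.
    set (p := q ^ (2 * n + 1)) in *.
    rewrite usum_nat_Series by apply (summable_row _ n Hs).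
    rewrite (Series_ext _ (fun r => (chi n * p) * p ^ r)).
    - rewrite Series_scal_l, Series_geom by (rewrite Rabs_right; lra).
      field. lra.
    - intros r. rewrite pow_mult. fold p. simpl. ring. }
  assert (Hsum : usum (fun n => chi n * (q ^ (2 * n + 1) / (1 - q ^ (2 * n + 1))))
    = (lam q - 1) / 2).
  { rewrite <- (usum_ext _ _ Hrow).
    rewrite (usum_swap (fun n r => chi n * q ^ ((2 * n + 1) * S r))) by exact Hs.
    unfold lam. rewrite usum_Z_fold by now apply lam_term_summable, base_pos.
    replace (lam_term q 0) with (/ 2) by (unfold lam_term; simpl; field).
    rewrite (usum_ext _ (fun r => lam_term q (Z.of_nat (S r)) + lam_term q (- Z.of_nat (S r)))).
    - field.
    - intros r. rewrite lam_term_fold by trivial. rewrite <- chi_odd_sum by apply Hpow.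
      apply usum_ext. intros n. rewrite <- pow_mult. do 2 f_equal. lia. }
  apply is_series_ext with
    (fun n => 2 * (chi n * (q ^ (2 * n + 1) / (1 - q ^ (2 * n + 1))))); [intros; simpl; ring|].
  replace (lam q - 1) with (2 * ((lam q - 1) / 2)) by field.
  apply (is_series_scal_l (V := R_NormedModule) 2 _ ((lam q - 1) / 2)).
  rewrite <- Hsum. apply usum_nat_is_series.
  apply (summable_nat_geom _ (1 / (1 - q)) q); try lra.
  - apply Rlt_le, Rdiv_lt_0_compat; lra.
  - intros n. specialize (Hpow (2 * n)%nat).
    replace (S (2 * n)) with (2 * n + 1)%nat in Hpow by lia.
    assert (Hn : q ^ (2 * n + 1) <= q ^ n) by (apply pow_le_pow; trivial; lia).
    assert (H1 : q ^ (2 * n + 1) <= q ^ 1) by (apply pow_le_pow; trivial; lia).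
    rewrite pow_1 in H1. set (p := q ^ (2 * n + 1)) in *.
    rewrite Rabs_mult, chi_abs, Rmult_1_l, Rabs_right
      by (apply Rle_ge, Rlt_le, Rdiv_lt_0_compat; lra).
    replace (1 / (1 - q) * q ^ n) with (q ^ n * / (1 - q)) by (field; lra).
    apply Rmult_le_compat; try lra.
    + left; apply Rinv_0_lt_compat; lra.
    + apply Rinv_le_contravar; lra.
Qed.

(** * The elliptic integral of a pair and its Landen transformation *)

Definition pair_form (a b t : R) : R := (a * cos t) ^ 2 + (b * sin t) ^ 2.

Definition ellI (a b : R) : R := RInt (fun t => / sqrt (pair_form a b t)) 0 (PI / 2).

Lemma cos_sqr t : cos t ^ 2 = 1 - sin t ^ 2.
Proof. assert (H := sin2_cos2 t). unfold Rsqr in H. simpl. lra. Qed.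

Lemma pair_form_pos a b t : 0 < a -> 0 < b -> 0 < pair_form a b t.
Proof.
  intros Ha Hb. unfold pair_form. assert (H := cos_sqr t). rewrite !Rpow_mult_distr, H.
  assert (H1 := pow2_ge_0 (sin t)). assert (H2 := pow2_ge_0 (cos t)).
  rewrite H in H2.
  assert (0 < a ^ 2) by now apply pow_lt. assert (0 < b ^ 2) by now apply pow_lt.
  destruct (Rle_lt_dec (sin t ^ 2) (1 / 2)); nra.
Qed.

Lemma pair_integrand_continuous a b t : 0 < a -> 0 < b ->
  continuous (fun t => / sqrt (pair_form a b t)) t.
Proof.
  intros Ha Hb. assert (H := pair_form_pos a b t Ha Hb).
  assert (H' := sqrt_lt_R0 _ H).
  apply (ex_derive_continuous (fun t => / sqrt (pair_form a b t))).
  unfold pair_form in *. simpl in *. auto_derive. repeat split; lra.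
Qed.

Lemma pair_integrand_ex a b x y : 0 < a -> 0 < b ->
  ex_RInt (fun t => / sqrt (pair_form a b t)) x y.
Proof.
  intros Ha Hb. apply (ex_RInt_continuous (V := R_CompleteNormedModule)).
  intros. now apply pair_integrand_continuous.
Qed.

(** The angle t + arctan ((b/a) tan t), in a form that is smooth at PI/2. *)
Definition landen_angle (a b t : R) : R :=
  2 * t - atan ((a - b) * (sin t * cos t) / (a * cos t ^ 2 + b * sin t ^ 2)).

Lemma landen_denom_pos a b t : 0 < a -> 0 < b -> 0 < a * cos t ^ 2 + b * sin t ^ 2.
Proof.
  intros Ha Hb. rewrite cos_sqr.
  assert (H1 := pow2_ge_0 (sin t)). assert (H2 := pow2_ge_0 (cos t)).
  rewrite cos_sqr in H2. destruct (Rle_lt_dec (sin t ^ 2) (1 / 2)); nra.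
Qed.

(** Both sides are the square of the modulus of (a cos t + i b sin t) exp (- i t). *)
Lemma landen_norm a b t :
  (a * cos t ^ 2 + b * sin t ^ 2) ^ 2 + ((a - b) * (sin t * cos t)) ^ 2 = pair_form a b t.
Proof. unfold pair_form. rewrite !Rpow_mult_distr, cos_sqr. ring. Qed.

Lemma landen_angle_derive a b t : 0 < a -> 0 < b ->
  is_derive (landen_angle a b) t
    ((a + b) * (a * cos t ^ 2 + b * sin t ^ 2) / pair_form a b t).
Proof.
  intros Ha Hb. assert (HD := landen_denom_pos a b t Ha Hb).
  assert (HN := pair_form_pos a b t Ha Hb). assert (Hn := landen_norm a b t).
  unfold landen_angle. auto_derive.
  - simpl in HD. lra.
  - set (s := sin t) in *. set (c := cos t) in *.
    assert (Hc : c ^ 2 = 1 - s ^ 2) by apply cos_sqr.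
    set (D := a * c ^ 2 + b * s ^ 2) in *. set (N := pair_form a b t) in *.
    replace (a * (c * (c * 1)) + b * (s * (s * 1))) with D by (unfold D; ring).
    transitivity (2 - (a - b) * ((c ^ 2 - s ^ 2) * D + 2 * (a - b) * (s ^ 2 * c ^ 2))
      / (D ^ 2 + ((a - b) * (s * c)) ^ 2)).
    + field. split; [rewrite Hn|]; lra.
    + rewrite Hn.
      replace ((a - b) * ((c ^ 2 - s ^ 2) * D + 2 * (a - b) * (s ^ 2 * c ^ 2)))
        with (2 * N - (a + b) * D).
      * field. lra.
      * rewrite <- Hn. unfold D. rewrite !Rpow_mult_distr, Hc. ring.
Qed.

Lemma landen_angle_cos a b t : 0 < a -> 0 < b ->
  cos (landen_angle a b t) ^ 2 = (a * cos t ^ 2 - b * sin t ^ 2) ^ 2 / pair_form a b t.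
Proof.
  intros Ha Hb. assert (HD := landen_denom_pos a b t Ha Hb).
  assert (HN := pair_form_pos a b t Ha Hb). assert (Hn := landen_norm a b t).
  unfold landen_angle. rewrite cos_minus, cos_atan, sin_atan, cos_2a, sin_2a.
  set (s := sin t) in *. set (c := cos t) in *.
  assert (Hc : c ^ 2 = 1 - s ^ 2) by apply cos_sqr.
  set (D := a * c ^ 2 + b * s ^ 2) in *. set (N := pair_form a b t) in *.
  set (u := (a - b) * (s * c) / D).
  assert (Hu : 1 + u² = N / D ^ 2).
  { rewrite <- Hn. unfold u, Rsqr. field. lra. }
  assert (HuP : 0 < 1 + u²) by (assert (H := Rle_0_sqr u); lra).
  transitivity ((c * c - s * s + 2 * s * c * u) ^ 2 / (sqrt (1 + u²)) ^ 2).
  - field. apply Rgt_not_eq, sqrt_lt_R0, HuP.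
  - rewrite pow2_sqrt by lra. rewrite Hu.
    replace (c * c - s * s + 2 * s * c * u) with ((a * c ^ 2 - b * s ^ 2) / D).
    + field. split; lra.
    + apply (Rmult_eq_reg_r D); [|lra].
      transitivity ((c ^ 2 - s ^ 2) * D + 2 * (a - b) * s ^ 2 * c ^ 2).
      * unfold D. field_simplify; [|fold D; lra]. rewrite !Hc.
        replace (c ^ 4) with ((c ^ 2) ^ 2) by ring. rewrite Hc. ring.
      * unfold u. field. lra.
Qed.

Lemma landen_pullback a b t : 0 < a -> 0 < b ->
  (a + b) * (a * cos t ^ 2 + b * sin t ^ 2) / pair_form a b t
    * / sqrt (pair_form ((a + b) / 2) (sqrt (a * b)) (landen_angle a b t))
  = 2 * / sqrt (pair_form a b t).
Proof.
  intros Ha Hb. assert (HD := landen_denom_pos a b t Ha Hb).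
  assert (HN := pair_form_pos a b t Ha Hb). assert (Hn := landen_norm a b t).
  assert (Hg := landen_angle_cos a b t Ha Hb).
  assert (Hab : 0 < a * b) by now apply Rmult_lt_0_compat.
  assert (E : pair_form ((a + b) / 2) (sqrt (a * b)) (landen_angle a b t)
    = ((a + b) / 2 * (a * cos t ^ 2 + b * sin t ^ 2)) ^ 2 / pair_form a b t).
  { unfold pair_form at 1. rewrite !Rpow_mult_distr, pow2_sqrt by lra.
    assert (Hs := cos_sqr (landen_angle a b t)).
    replace (sin (landen_angle a b t) ^ 2) with (1 - cos (landen_angle a b t) ^ 2) by lra.
    rewrite Hg.
    assert (K : ((a - b) / 2) ^ 2 * (a * cos t ^ 2 - b * sin t ^ 2) ^ 2
      + a * b * pair_form a b t
      = ((a + b) / 2) ^ 2 * (a * cos t ^ 2 + b * sin t ^ 2) ^ 2).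
    { unfold pair_form. rewrite !(Rpow_mult_distr _ (cos t)), cos_sqr. field. }
    rewrite <- K. field. lra. }
  rewrite E, sqrt_div_alt, sqrt_pow2 by (trivial; apply Rmult_le_pos; lra).
  assert (Hsq := sqrt_lt_R0 _ HN). rewrite <- (pow2_sqrt (pair_form a b t)) at 1 by lra.
  field. repeat split; lra.
Qed.

Lemma pair_integrand_half a b : 0 < a -> 0 < b ->
  RInt (fun t => / sqrt (pair_form a b t)) 0 PI = 2 * ellI a b.
Proof.
  intros Ha Hb. unfold ellI.
  rewrite <- (RInt_Chasles (V := R_CompleteNormedModule) _ 0 (PI / 2) PI)
    by now apply pair_integrand_ex.
  assert (E : RInt (fun t => / sqrt (pair_form a b t)) (PI / 2) PI
    = RInt (fun t => / sqrt (pair_form a b t)) 0 (PI / 2)).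
  { assert (H := RInt_comp_lin (V := R_CompleteNormedModule)
      (fun t => / sqrt (pair_form a b t)) (-1) PI 0 (PI / 2)).
    replace (-1 * 0 + PI) with PI in H by ring.
    replace (-1 * (PI / 2) + PI) with (PI / 2) in H by field.
    rewrite <- (opp_RInt_swap (V := R_CompleteNormedModule)) by now apply pair_integrand_ex.
    rewrite <- H by now apply pair_integrand_ex.
    rewrite (RInt_scal (V := R_CompleteNormedModule)
      (fun t => / sqrt (pair_form a b (-1 * t + PI)))).
    - transitivity (RInt (fun t => / sqrt (pair_form a b (-1 * t + PI))) 0 (PI / 2)).
      + unfold scal, opp; simpl; unfold mult; simpl. ring.
      + apply RInt_ext. intros t _. do 2 f_equal. unfold pair_form.
        replace (-1 * t + PI) with (PI - t) by ring.
        rewrite sin_PI_x, cos_minus, cos_PI, sin_PI. ring.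
    - apply (ex_RInt_continuous (V := R_CompleteNormedModule)). intros t _.
      apply (continuous_comp (fun t => -1 * t + PI) (fun t => / sqrt (pair_form a b t))).
      + apply (ex_derive_continuous (fun t => -1 * t + PI)). auto_derive. trivial.
      + now apply pair_integrand_continuous. }
  rewrite E. unfold plus; simpl. ring.
Qed.

(** The invariance of the integral under the arithmetic-geometric step comes from the
    substitution of [landen_angle], which maps [0, PI/2] onto [0, PI]. *)
Lemma ellI_landen a b : 0 < a -> 0 < b ->
  ellI ((a + b) / 2) (sqrt (a * b)) = ellI a b.
Proof.
  intros Ha Hb.
  assert (Ha1 : 0 < (a + b) / 2) by lra.
  assert (Hb1 : 0 < sqrt (a * b)) by now apply sqrt_lt_R0, Rmult_lt_0_compat.
  set (h := fun t => / sqrt (pair_form ((a + b) / 2) (sqrt (a * b)) t)).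
  assert (H := RInt_comp (V := R_CompleteNormedModule) h (landen_angle a b)
    (fun t => (a + b) * (a * cos t ^ 2 + b * sin t ^ 2) / pair_form a b t) 0 (PI / 2)).
  replace (landen_angle a b 0) with 0 in H.
  2:{ unfold landen_angle. rewrite sin_0. unfold Rdiv.
      rewrite !Rmult_0_l, !Rmult_0_r, !Rmult_0_l, atan_0. ring. }
  replace (landen_angle a b (PI / 2)) with PI in H.
  2:{ unfold landen_angle. rewrite cos_PI2. unfold Rdiv.
      rewrite !Rmult_0_r, !Rmult_0_l, atan_0. field. }
  unfold h in H. rewrite pair_integrand_half in H by trivial.
  apply (Rmult_eq_reg_l 2); [|lra]. rewrite <- H.
  - unfold ellI. rewrite <- (RInt_scal (V := R_CompleteNormedModule) _ 0 (PI / 2) 2)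
      by now apply pair_integrand_ex.
    apply RInt_ext. intros t _. apply landen_pullback; trivial.
  - intros t _. now apply pair_integrand_continuous.
  - intros t _. split; [now apply landen_angle_derive|].
    assert (HN := pair_form_pos a b t Ha Hb).
    apply (ex_derive_continuous (fun t =>
      (a + b) * (a * cos t ^ 2 + b * sin t ^ 2) / pair_form a b t)).
    unfold pair_form in *. auto_derive. simpl in HN. lra.
Qed.

Lemma ellI_scal c a b : 0 < c -> 0 < a -> 0 < b -> ellI (c * a) (c * b) = ellI a b / c.
Proof.
  intros Hc Ha Hb. unfold ellI.
  transitivity (/ c * RInt (fun t => / sqrt (pair_form a b t)) 0 (PI / 2));
    [|unfold Rdiv; ring].
  rewrite <- (RInt_scal (V := R_CompleteNormedModule) _ 0 (PI / 2) (/ c))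
    by now apply pair_integrand_ex.
  apply RInt_ext. intros t _.
  replace (pair_form (c * a) (c * b) t) with (c ^ 2 * pair_form a b t)
    by (unfold pair_form; ring).
  assert (HN := pair_form_pos a b t Ha Hb).
  rewrite sqrt_mult, sqrt_pow2 by (try apply pow2_ge_0; lra).
  unfold scal; simpl; unfold mult; simpl. apply Rinv_mult.
Qed.

Lemma ellI_pos a b : 0 < a -> 0 < b -> 0 < ellI a b.
Proof.
  intros Ha Hb. assert (HP := PI_RGT_0).
  replace 0 with (RInt (fun _ => 0) 0 (PI / 2))
    by (rewrite RInt_const; unfold scal; simpl; unfold mult; simpl; ring).
  apply RInt_lt; [lra| | |].
  - intros; now apply pair_integrand_continuous.
  - intros; apply continuous_const.
  - intros t _. apply Rinv_0_lt_compat, sqrt_lt_R0. now apply pair_form_pos.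
Qed.

Lemma RInt_const_0_PI2 c : RInt (fun _ => c) 0 (PI / 2) = PI / 2 * c.
Proof. rewrite RInt_const. unfold scal; simpl; unfold mult; simpl. ring. Qed.

Lemma ellI_bounds a b : 0 < b <= a -> PI / 2 * / a <= ellI a b <= PI / 2 * / b.
Proof.
  intros Hab. assert (HP := PI_RGT_0).
  rewrite <- !RInt_const_0_PI2.
  assert (Hs : forall t, b <= sqrt (pair_form a b t) <= a).
  { intros t. assert (Hc := cos_sqr t). assert (H1 := pow2_ge_0 (sin t)).
    assert (H2 := pow2_ge_0 (cos t)).
    assert (b ^ 2 <= a ^ 2) by (apply pow_incr; lra).
    split.
    - rewrite <- (sqrt_pow2 b) at 1 by lra. apply sqrt_le_1_alt.
      unfold pair_form. rewrite !Rpow_mult_distr. nra.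
    - rewrite <- (sqrt_pow2 a) at 2 by lra. apply sqrt_le_1_alt.
      unfold pair_form. rewrite !Rpow_mult_distr. nra. }
  split; apply RInt_le.
  - lra.
  - apply ex_RInt_const.
  - apply pair_integrand_ex; lra.
  - intros t _. destruct (Hs t). apply Rinv_le_contravar; lra.
  - lra.
  - apply pair_integrand_ex; lra.
  - apply ex_RInt_const.
  - intros t _. destruct (Hs t). apply Rinv_le_contravar; lra.
Qed.

(** Splitting 1 as sin t + (1 - sin t), the first part has an elementary primitive and
    the second contributes a bounded integrand, since a (1 - sin t) <= a |cos t|. *)
Lemma ellI_log_bounds a b c : 0 < b -> 0 < c -> 0 < a -> a ^ 2 = b ^ 2 + c ^ 2 ->
  ln ((a + b) / c) / b <= ellI a c <= ln ((a + b) / c) / b + PI / 2 * / a.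
Proof.
  intros Hb Hc Ha Habc. assert (HP := PI_RGT_0).
  assert (Hform : forall t, pair_form a c t = b ^ 2 * cos t ^ 2 + c ^ 2).
  { intros t. unfold pair_form. rewrite !Rpow_mult_distr, Habc.
    assert (H := cos_sqr t). replace (sin t ^ 2) with (1 - cos t ^ 2) by lra. ring. }
  set (F := fun t => - / b * ln (b * cos t + sqrt (pair_form a c t))).
  set (f := fun t => sin t * / sqrt (pair_form a c t)).
  assert (Hlog : forall t, 0 < b * cos t + sqrt (pair_form a c t)).
  { intros t. assert (Hlt : Rabs (b * cos t) < sqrt (pair_form a c t)).
    { rewrite <- sqrt_Rsqr_abs. apply sqrt_lt_1_alt. split; [apply Rle_0_sqr|].
      rewrite Hform. unfold Rsqr. assert (0 < c ^ 2) by now apply pow_lt. nra. }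
    apply Rabs_lt_between in Hlt. lra. }
  assert (Hf : is_RInt f 0 (PI / 2) (ln ((a + b) / c) / b)).
  { replace (ln ((a + b) / c) / b) with (minus (F (PI / 2)) (F 0)).
    - apply (is_RInt_derive (V := R_CompleteNormedModule) F f).
      + intros t _. assert (Hl := Hlog t). assert (HN := pair_form_pos a c t Ha Hc).
        assert (Hsq := sqrt_lt_R0 _ HN).
        unfold F, f. rewrite Hform in *.
        apply is_derive_ext with
          (fun t => - / b * ln (b * cos t + sqrt (b ^ 2 * cos t ^ 2 + c ^ 2))).
        { intros x. now rewrite Hform. }
        auto_derive; replace (b * (b * 1) * (cos t * (cos t * 1)) + c * (c * 1))
          with (b ^ 2 * cos t ^ 2 + c ^ 2) by ring.
        * repeat split; trivial.
        * field. repeat split; lra.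
      + intros t _. apply (continuous_mult sin).
        * apply continuous_sin.
        * now apply pair_integrand_continuous.
    - unfold F, minus, plus, opp; simpl. rewrite !Hform, cos_PI2, cos_0.
      replace (b ^ 2 * 0 ^ 2 + c ^ 2) with (c ^ 2) by ring.
      replace (b ^ 2 * 1 ^ 2 + c ^ 2) with (a ^ 2) by (rewrite Habc; ring).
      rewrite !sqrt_pow2 by lra. rewrite ln_div by lra.
      replace (b * 0 + c) with c by ring. replace (b * 1 + a) with (a + b) by ring.
      field. lra. }
  assert (Hex : ex_RInt f 0 (PI / 2)) by (eexists; exact Hf).
  rewrite <- (is_RInt_unique _ _ _ _ Hf). split.
  - apply RInt_le; [lra|trivial|now apply pair_integrand_ex|].
    intros t _. unfold f. rewrite <- (Rmult_1_l (/ _)) at 2.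
    apply Rmult_le_compat_r; [|apply SIN_bound].
    left. apply Rinv_0_lt_compat, sqrt_lt_R0. now apply pair_form_pos.
  - rewrite <- RInt_const_0_PI2.
    rewrite <- (RInt_plus (V := R_CompleteNormedModule)) by (trivial; apply ex_RInt_const).
    apply RInt_le; [lra|now apply pair_integrand_ex| |].
    + apply (ex_RInt_plus (V := R_CompleteNormedModule)); trivial. apply ex_RInt_const.
    + intros t Ht. unfold f, plus; simpl.
      assert (HN := pair_form_pos a c t Ha Hc). assert (Hsq := sqrt_lt_R0 _ HN).
      assert (Hs : a * (1 - sin t) <= sqrt (pair_form a c t)).
      { assert (H1 := SIN_bound t).
        assert (H2 : 0 <= sin t) by (apply sin_ge_0; lra).
        rewrite <- (sqrt_pow2 (a * (1 - sin t))) by (apply Rmult_le_pos; lra).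
        apply sqrt_le_1_alt. unfold pair_form. rewrite !Rpow_mult_distr, cos_sqr.
        assert (0 < a ^ 2) by now apply pow_lt.
        assert (0 <= c ^ 2 * sin t ^ 2) by (apply Rmult_le_pos; apply pow2_ge_0).
        assert (0 <= a ^ 2 * (2 * (sin t * (1 - sin t))))
          by (apply Rmult_le_pos; [lra|nra]).
        nra. }
      set (S := sqrt (pair_form a c t)) in *.
      apply (Rmult_le_reg_r (a * S)); [now apply Rmult_lt_0_compat|].
      field_simplify; lra.
Qed.

(** * The periods in terms of the nome *)

(** The squares of the Jacobi theta constants theta_3, theta_4 and theta_2; the last one
    is given through Jacobi's identity theta_2^4 = theta_3^4 - theta_4^4. *)
Definition thA (q : R) : R := phi q ^ 2.
Definition thB (q : R) : R := phi (- q) ^ 2.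
Definition thC (q : R) : R := sqrt (thA q ^ 2 - thB q ^ 2).
Definition odd_part (q : R) : R := usum (fun j : Z => powerRZ q (4 * (j * j + j))).

Lemma odd_part_summable q : base q ->
  summable (fun j : Z => powerRZ q (4 * (j * j + j))).
Proof.
  intros Hq. assert (Hq0 := base_neq q Hq).
  assert (H := phi_summable q Hq).
  apply (summable_comp (fun j => 2 * j + 1)%Z) in H; [|intros; lia].
  apply (summable_scal (/ q)) in H. revert H. apply summable_ext. intros j.
  replace ((2 * j + 1) * (2 * j + 1))%Z with (1 + 4 * (j * j + j))%Z by ring.
  rewrite powerRZ_add by trivial. simpl. field. trivial.
Qed.

Lemma odd_part_ge_1 q : 0 < q < 1 -> 1 <= odd_part q.
Proof.
  intros Hq. apply (usum_ge_term (fun j => powerRZ q (4 * (j * j + j))) 0%Z).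
  - now apply odd_part_summable, base_pos.
  - intros j. apply powerRZ_le. lra.
Qed.

Lemma odd_part_mono p q : 0 < p <= q -> q < 1 -> odd_part p <= odd_part q.
Proof.
  intros Hp Hq. apply usum_le; try (apply odd_part_summable, base_pos; lra).
  intros j. replace (4 * (j * j + j))%Z with (Z.of_nat (Z.to_nat (4 * (j * j + j)))) by nia.
  rewrite <- !pow_powerRZ. apply pow_incr. lra.
Qed.

Lemma thA_pos q : 0 < q < 1 -> 0 < thA q.
Proof. intros Hq. now apply pow_lt, phi_pos. Qed.

Lemma thB_pos q : 0 < q < 1 -> 0 < thB q.
Proof. intros Hq. now apply pow_lt, phi_opp_pos. Qed.

Lemma thA_minus_thB q : 0 < q < 1 -> thA q - thB q = q * (4 * phi (q ^ 4) * odd_part q).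
Proof.
  intros Hq. assert (Hb := base_pos q Hq).
  assert (H1 := phi_add_opp q Hb). assert (H2 := phi_sub_opp q Hb).
  fold (odd_part q) in H2. unfold thA, thB.
  replace (phi q ^ 2 - phi (- q) ^ 2) with ((phi q + phi (- q)) * (phi q - phi (- q))) by ring.
  rewrite H1, H2. ring.
Qed.

Lemma thB_lt_thA q : 0 < q < 1 -> thB q < thA q.
Proof.
  intros Hq. assert (H := thA_minus_thB q Hq).
  assert (H1 := odd_part_ge_1 q Hq). assert (H2 := phi_pos _ (pow_range q 3 Hq)).
  assert (0 < q * (4 * phi (q ^ 4) * odd_part q)); [|lra].
  repeat apply Rmult_lt_0_compat; lra.
Qed.

Lemma thA_thB_sqr_pos q : 0 < q < 1 -> 0 < thA q ^ 2 - thB q ^ 2.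
Proof.
  intros Hq. assert (H := thB_lt_thA q Hq). assert (H1 := thB_pos q Hq). nra.
Qed.

Lemma thC_pos q : 0 < q < 1 -> 0 < thC q.
Proof. intros Hq. now apply sqrt_lt_R0, thA_thB_sqr_pos. Qed.

Lemma thA_pythagoras q : 0 < q < 1 -> thA q ^ 2 = thB q ^ 2 + thC q ^ 2.
Proof.
  intros Hq. assert (H := thA_thB_sqr_pos q Hq). unfold thC. rewrite pow2_sqrt by lra. ring.
Qed.

Lemma thA_agm q : 0 < q < 1 -> thA (q ^ 2) = (thA q + thB q) / 2.
Proof. intros Hq. assert (H := phi_sqr_add q (base_pos q Hq)). unfold thA, thB. lra. Qed.

Lemma thB_agm q : 0 < q < 1 -> thB (q ^ 2) = sqrt (thA q * thB q).
Proof.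
  intros Hq. unfold thA, thB. rewrite <- phi_mul_opp by now apply base_pos.
  assert (H1 := phi_pos q Hq). assert (H2 := phi_opp_pos q Hq).
  rewrite <- Rpow_mult_distr, sqrt_pow2; trivial.
  left. now apply Rmult_lt_0_compat.
Qed.

Lemma thC_agm q : 0 < q < 1 -> thC (q ^ 2) = (thA q - thB q) / 2.
Proof.
  intros Hq. unfold thC. rewrite thA_agm, thB_agm by trivial.
  assert (H1 := thA_pos q Hq). assert (H2 := thB_pos q Hq). assert (H3 := thB_lt_thA q Hq).
  rewrite pow2_sqrt by (left; now apply Rmult_lt_0_compat).
  replace (((thA q + thB q) / 2) ^ 2 - thA q * thB q) with (((thA q - thB q) / 2) ^ 2) by field.
  apply sqrt_pow2. lra.
Qed.

Lemma thA_tower q : 0 < q < 1 -> is_lim_seq (fun n => thA (tower q n)) 1.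
Proof.
  intros Hq. replace (Finite 1) with (Finite (1 * 1)) by (f_equal; ring).
  apply is_lim_seq_ext with (fun n => phi (tower q n) * phi (tower q n)).
  - intros; unfold thA; ring.
  - apply is_lim_seq_mult'; now apply phi_tower.
Qed.

Lemma thB_tower q : 0 < q < 1 -> is_lim_seq (fun n => thB (tower q n)) 1.
Proof.
  intros Hq. replace (Finite 1) with (Finite (1 * 1)) by (f_equal; ring).
  apply is_lim_seq_ext with (fun n => phi (- tower q n) * phi (- tower q n)).
  - intros; unfold thB; ring.
  - apply is_lim_seq_mult'; now apply phi_opp_tower.
Qed.

Lemma squeeze_const (u w : nat -> R) (x l : R) :
  (forall n, u n <= x <= w n) -> is_lim_seq u l -> is_lim_seq w l -> x = l.
Proof.
  intros H Hu Hw.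
  assert (Hx : is_lim_seq (fun _ => x) l) by now apply (is_lim_seq_le_le u _ w).
  apply is_lim_seq_unique in Hx. rewrite Lim_seq_const in Hx. congruence.
Qed.

(** Since (thA, thB) runs through the arithmetic-geometric iteration under q -> q^2 and
    converges to (1, 1), the invariant integral equals that of the pair (1, 1). *)
Lemma ellI_AB q : 0 < q < 1 -> ellI (thA q) (thB q) = PI / 2.
Proof.
  intros Hq.
  assert (Hc : forall n, ellI (thA (tower q n)) (thB (tower q n)) = ellI (thA q) (thB q)).
  { induction n as [|n IH].
    - unfold tower; simpl. now rewrite Rmult_1_r.
    - assert (Ht := tower_range q n Hq).
      rewrite tower_S, thA_agm, thB_agm, ellI_landen
        by (trivial; (now apply thA_pos) || (now apply thB_pos)).
      exact IH. }
  apply (squeeze_const (fun n => PI / 2 * / thA (tower q n))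
    (fun n => PI / 2 * / thB (tower q n))).
  - intros n. rewrite <- (Hc n). assert (Ht := tower_range q n Hq).
    apply ellI_bounds. split; [now apply thB_pos|left; now apply thB_lt_thA].
  - replace (Finite (PI / 2)) with (Finite (PI / 2 / 1)) by (f_equal; field).
    apply is_lim_seq_div'; [apply is_lim_seq_const|now apply thA_tower|lra].
  - replace (Finite (PI / 2)) with (Finite (PI / 2 / 1)) by (f_equal; field).
    apply is_lim_seq_div'; [apply is_lim_seq_const|now apply thB_tower|lra].
Qed.

(** The arithmetic-geometric step from (thA, thC) at q^2 leads back to half of
    (thA, thC) at q. *)
Lemma ellI_AC_sqr q : 0 < q < 1 ->
  ellI (thA (q ^ 2)) (thC (q ^ 2)) = 2 * ellI (thA q) (thC q).
Proof.
  intros Hq. assert (Hq2 := pow_range q 1 Hq).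
  assert (HA := thA_pos q Hq). assert (HB := thB_pos q Hq). assert (HC := thC_pos q Hq).
  rewrite <- ellI_landen by ((now apply thA_pos) || (now apply thC_pos)).
  rewrite thA_agm, thC_agm by trivial.
  replace (((thA q + thB q) / 2 + (thA q - thB q) / 2) / 2) with (/ 2 * thA q) by field.
  replace ((thA q + thB q) / 2 * ((thA q - thB q) / 2)) with ((/ 2 * thC q) ^ 2).
  - rewrite sqrt_pow2 by lra. rewrite ellI_scal by lra. field.
  - assert (H := thA_pythagoras q Hq).
    rewrite Rpow_mult_distr. replace (thC q ^ 2) with (thA q ^ 2 - thB q ^ 2) by lra. field.
Qed.

Lemma log_AB_C q : 0 < q < 1 ->
  ln ((thA q + thB q) / thC q)
  = (ln (thA q + thB q) - ln (4 * phi (q ^ 4)) - ln (odd_part q) - ln q) / 2.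
Proof.
  intros Hq.
  assert (HA := thA_pos q Hq). assert (HB := thB_pos q Hq). assert (HC := thC_pos q Hq).
  assert (HAB := thB_lt_thA q Hq).
  assert (H1 := odd_part_ge_1 q Hq). assert (H2 := phi_pos _ (pow_range q 3 Hq)).
  assert (E : 2 * ln (thC q) = ln (thA q + thB q) + ln (thA q - thB q)).
  { rewrite <- ln_mult by lra.
    replace ((thA q + thB q) * (thA q - thB q)) with (thC q * thC q)
      by (assert (H := thA_pythagoras q Hq); lra).
    rewrite ln_mult by lra. ring. }
  assert (E' := thA_minus_thB q Hq).
  rewrite E', 2!ln_mult in E by (try apply Rmult_lt_0_compat; lra).
  rewrite ln_div by lra. lra.
Qed.

Lemma tower_ln q n : 0 < q < 1 -> ln (tower q n) = 2 ^ n * ln q.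
Proof.
  intros Hq. unfold tower. rewrite ln_pow by lra. f_equal. rewrite pow_INR. reflexivity.
Qed.

Lemma is_lim_seq_half_pow (u : nat -> R) (l : R) :
  is_lim_seq u l -> is_lim_seq (fun n => (/ 2) ^ n * u n) 0.
Proof.
  intros H. replace (Finite 0) with (Finite (0 * l)) by (f_equal; ring).
  apply is_lim_seq_mult'; trivial. apply is_lim_seq_geom. rewrite Rabs_right; lra.
Qed.

(** The value doubles under q -> q^2, so it is determined by its size as q -> 0, where
    the logarithmic estimate gives - (ln q) / 2 up to a bounded error. *)
Lemma ellI_AC q : 0 < q < 1 -> ellI (thA q) (thC q) = - ln q / 2.
Proof.
  intros Hq. assert (Ht := fun n => tower_range q n Hq).
  assert (Hc : forall n, ellI (thA q) (thC q)
    = (/ 2) ^ n * ellI (thA (tower q n)) (thC (tower q n))).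
  { induction n as [|n IH].
    - unfold tower; simpl. now rewrite Rmult_1_r, Rmult_1_l.
    - rewrite tower_S, ellI_AC_sqr by trivial. rewrite IH. simpl. field. }
  set (lo := fun n => ((/ 2) ^ n * (ln (thA (tower q n) + thB (tower q n))
      - ln (4 * phi (tower q (S (S n)))))
    - (/ 2) ^ n * ln (odd_part (tower q n)) - ln q) / 2 / thB (tower q n)).
  assert (Hlo : forall n,
    (/ 2) ^ n * (ln ((thA (tower q n) + thB (tower q n)) / thC (tower q n))
      / thB (tower q n)) = lo n).
  { intros n. rewrite log_AB_C, tower_ln by trivial. unfold lo.
    replace (tower q n ^ 4) with (tower q (S (S n))) by (rewrite !tower_S; ring).
    assert (HB := thB_pos _ (Ht n)).
    assert (E : (/ 2) ^ n * 2 ^ n = 1)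
      by (rewrite <- Rpow_mult_distr, Rinv_l, pow1; lra).
    replace (ln q) with ((/ 2) ^ n * 2 ^ n * ln q) at 2 by (rewrite E; ring).
    field. lra. }
  assert (Hlim : is_lim_seq lo (- ln q / 2)).
  { replace (Finite (- ln q / 2)) with (Finite ((0 - 0 - ln q) / 2 / 1)) by (f_equal; field).
    apply is_lim_seq_div'; [|now apply thB_tower|lra].
    apply is_lim_seq_div'; [|apply is_lim_seq_const|lra].
    apply is_lim_seq_minus'; [|apply is_lim_seq_const].
    apply is_lim_seq_minus'.
    - apply (is_lim_seq_half_pow _ (ln (1 + 1) - ln (4 * 1))).
      apply is_lim_seq_minus'.
      + apply (is_lim_seq_continuous ln).
        * apply derivable_continuous_pt. exists (/ (1 + 1)). apply derivable_pt_lim_ln. lra.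
        * apply is_lim_seq_plus'; [now apply thA_tower|now apply thB_tower].
      + apply (is_lim_seq_continuous ln).
        * apply derivable_continuous_pt. exists (/ (4 * 1)). apply derivable_pt_lim_ln. lra.
        * apply is_lim_seq_mult'; [apply is_lim_seq_const|].
          apply (is_lim_seq_incr_1 (fun n => phi (tower q (S n)))).
          apply (is_lim_seq_incr_1 (fun n => phi (tower q n))). now apply phi_tower.
    - apply is_lim_seq_le_le with (u := fun _ => 0)
        (w := fun n => (/ 2) ^ n * ln (odd_part q)).
      + intros n. assert (H1 := odd_part_ge_1 _ (Ht n)).
        assert (Hp : 0 <= (/ 2) ^ n) by (apply pow_le; lra).
        assert (Hm : odd_part (tower q n) <= odd_part q).
        { apply odd_part_mono; [split; [apply Ht|]|lra].
          unfold tower. rewrite <- (pow_1 q) at 2. apply pow_le_pow; trivial.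
          clear; induction n; simpl; lia. }
        assert (H0 : 0 <= ln (odd_part (tower q n)))
          by (rewrite <- ln_1; apply ln_le; lra).
        split; [now apply Rmult_le_pos|].
        apply Rmult_le_compat_l; trivial. apply ln_le; lra.
      + apply is_lim_seq_const.
      + apply (is_lim_seq_half_pow (fun _ => ln (odd_part q)) (ln (odd_part q))).
        apply is_lim_seq_const. }
  apply (squeeze_const lo (fun n => lo n + (/ 2) ^ n * (PI / 2 * / thA (tower q n)))); trivial.
  - intros n. rewrite (Hc n), <- Hlo, <- Rmult_plus_distr_l.
    assert (Hp : 0 <= (/ 2) ^ n) by (apply pow_le; lra).
    destruct (ellI_log_bounds (thA (tower q n)) (thB (tower q n)) (thC (tower q n)))
      as [H1 H2]; [now apply thB_pos|now apply thC_pos|now apply thA_pos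
        |now apply thA_pythagoras|].
    split; now apply Rmult_le_compat_l.
  - replace (Finite (- ln q / 2)) with (Finite (- ln q / 2 + 0)) by (f_equal; ring).
    apply is_lim_seq_plus'; trivial.
    apply (is_lim_seq_half_pow _ (PI / 2 / 1)).
    apply is_lim_seq_div'; [apply is_lim_seq_const|now apply thA_tower|lra].
Qed.

(** * Complete integrals *)

Definition delta2 (k t : R) : R := 1 - k ^ 2 * sin t ^ 2.

Lemma delta2_pos k t : k ^ 2 < 1 -> 0 < delta2 k t.
Proof.
  intros Hk. unfold delta2. assert (H := cos_sqr t). assert (H1 := pow2_ge_0 (cos t)).
  assert (H2 := pow2_ge_0 (sin t)). assert (H3 := pow2_ge_0 k). nra.
Qed.

Lemma sqr_lt_1 k : 0 < k < 1 -> 0 < k ^ 2 < 1.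
Proof. intros; simpl; nra. Qed.

Lemma comp_modulus_sqr k : 0 < k < 1 -> comp_modulus k ^ 2 = 1 - k ^ 2.
Proof. intros H. unfold comp_modulus. apply pow2_sqrt. assert (H1 := sqr_lt_1 k H). lra. Qed.

Lemma comp_modulus_range k : 0 < k < 1 -> 0 < comp_modulus k < 1.
Proof.
  intros H. assert (H1 := sqr_lt_1 k H). unfold comp_modulus. split.
  - apply sqrt_lt_R0. lra.
  - rewrite <- sqrt_1 at 2. apply sqrt_lt_1_alt. lra.
Qed.

Lemma ellK_eq_ellI k l : 0 < l -> k ^ 2 + l ^ 2 = 1 -> ellK k = ellI 1 l.
Proof.
  intros Hl H. unfold ellK, ellI. apply RInt_ext. intros t _.
  unfold Rdiv. rewrite Rmult_1_l. do 2 f_equal. unfold pair_form.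
  rewrite Rmult_1_l, Rpow_mult_distr, cos_sqr.
  replace (l ^ 2) with (1 - k ^ 2) by lra. ring.
Qed.

Lemma ellK_period k : 0 < k < 1 -> ellK k = ellI 1 (comp_modulus k).
Proof.
  intros H. apply ellK_eq_ellI; [now apply comp_modulus_range|].
  rewrite comp_modulus_sqr by trivial. ring.
Qed.

Lemma ellK_comp_period k : 0 < k < 1 -> ellK (comp_modulus k) = ellI 1 k.
Proof.
  intros H. apply ellK_eq_ellI; [lra|]. rewrite comp_modulus_sqr by trivial. ring.
Qed.

Lemma ellK_pos k : 0 < k < 1 -> 0 < ellK k.
Proof.
  intros H. rewrite ellK_period by trivial. apply ellI_pos; [lra|now apply comp_modulus_range].
Qed.

Lemma ellI_decr k l : 0 < k < l -> ellI 1 l < ellI 1 k.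
Proof.
  intros H. assert (HP := PI_RGT_0). apply RInt_lt; [lra|..];
    try (intros; apply pair_integrand_continuous; lra).
  intros t Ht. apply Rinv_lt_contravar.
  - apply Rmult_lt_0_compat; apply sqrt_lt_R0, pair_form_pos; lra.
  - apply sqrt_lt_1_alt. split; [left; apply pair_form_pos; lra|].
    unfold pair_form. rewrite !Rpow_mult_distr.
    assert (0 < sin t) by (apply sin_gt_0; lra).
    assert (0 < sin t ^ 2) by now apply pow_lt.
    assert (k ^ 2 < l ^ 2) by (simpl; nra). nra.
Qed.

Definition ratio (k : R) : R := ellK (comp_modulus k) / ellK k.

Definition nome (k : R) : R := exp (- (PI * ratio k)).

Lemma ratio_pos k : 0 < k < 1 -> 0 < ratio k.
Proof.
  intros H. apply Rdiv_lt_0_compat; apply ellK_pos; trivial. now apply comp_modulus_range.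
Qed.

Lemma exp_neg_range x : 0 < x -> 0 < exp (- x) < 1.
Proof.
  intros H. split; [apply exp_pos|]. rewrite <- exp_0. apply exp_increasing. lra.
Qed.

Lemma nome_range k : 0 < k < 1 -> 0 < nome k < 1.
Proof.
  intros H. apply exp_neg_range, Rmult_lt_0_compat; [apply PI_RGT_0|now apply ratio_pos].
Qed.

Lemma ratio_decr k l : 0 < k < l -> l < 1 -> ratio l < ratio k.
Proof.
  intros H Hl. unfold ratio. rewrite !ellK_comp_period, !ellK_period by lra.
  assert (Hc : comp_modulus l < comp_modulus k).
  { apply sqrt_lt_1_alt. simpl. nra. }
  assert (H1 := comp_modulus_range k ltac:(lra)).
  assert (H2 := comp_modulus_range l ltac:(lra)).
  apply Rmult_gt_0_lt_compat.
  - apply Rinv_0_lt_compat, ellI_pos; lra.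
  - apply ellI_pos; lra.
  - now apply ellI_decr.
  - apply Rinv_lt_contravar; [apply Rmult_lt_0_compat; apply ellI_pos; lra|].
    apply ellI_decr. lra.
Qed.

Lemma theta_modulus_range q : 0 < q < 1 -> 0 < thC q / thA q < 1.
Proof.
  intros Hq. assert (HA := thA_pos q Hq). assert (HB := thB_pos q Hq).
  assert (HC := thC_pos q Hq). assert (H := thA_pythagoras q Hq).
  split; [now apply Rdiv_lt_0_compat|].
  apply (Rmult_lt_reg_r (thA q)); trivial. unfold Rdiv.
  rewrite Rmult_assoc, Rinv_l by lra. nra.
Qed.

Lemma theta_comp_modulus q : 0 < q < 1 -> comp_modulus (thC q / thA q) = thB q / thA q.
Proof.
  intros Hq. assert (HA := thA_pos q Hq). assert (HB := thB_pos q Hq).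
  assert (H := thA_pythagoras q Hq). unfold comp_modulus.
  replace (1 - (thC q / thA q) ^ 2) with ((thB q / thA q) ^ 2).
  - apply sqrt_pow2. left. now apply Rdiv_lt_0_compat.
  - replace ((thC q / thA q) ^ 2) with (thC q ^ 2 / thA q ^ 2) by (field; lra).
    replace (thC q ^ 2) with (thA q ^ 2 - thB q ^ 2) by lra. field. lra.
Qed.

Lemma theta_ellI q b : 0 < q < 1 -> 0 < b -> ellI 1 (b / thA q) = thA q * ellI (thA q) b.
Proof.
  intros Hq Hb. assert (HA := thA_pos q Hq).
  assert (Hi := Rinv_0_lt_compat _ HA).
  assert (H := ellI_scal (/ thA q) (thA q) b Hi HA Hb).
  rewrite Rinv_l in H by lra. unfold Rdiv. rewrite (Rmult_comm b), H.
  unfold Rdiv. rewrite Rinv_inv. ring.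
Qed.

Lemma theta_ratio q : 0 < q < 1 -> ratio (thC q / thA q) = - ln q / PI.
Proof.
  intros Hq. assert (HA := thA_pos q Hq). assert (HP := PI_RGT_0).
  assert (Hm := theta_modulus_range q Hq). unfold ratio.
  rewrite ellK_comp_period, ellK_period, theta_comp_modulus by trivial.
  rewrite !theta_ellI by (trivial; (now apply thB_pos) || (now apply thC_pos)).
  rewrite ellI_AB, ellI_AC by trivial. field. split; lra.
Qed.

(** The modulus of nome q has K'/K = - (ln q) / PI, and K'/K is strictly decreasing. *)
Lemma theta_modulus_nome k : 0 < k < 1 -> thC (nome k) / thA (nome k) = k.
Proof.
  intros Hk. assert (Hq := nome_range k Hk). assert (HP := PI_RGT_0).
  assert (Hm := theta_modulus_range _ Hq).
  assert (E : ratio (thC (nome k) / thA (nome k)) = ratio k).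
  { rewrite theta_ratio by trivial. unfold nome. rewrite ln_exp. field. lra. }
  destruct (Rtotal_order (thC (nome k) / thA (nome k)) k) as [H|[H|H]]; trivial.
  - assert (H' := ratio_decr _ _ (conj (proj1 Hm) H) (proj2 Hk)). lra.
  - assert (H' := ratio_decr _ _ (conj (proj1 Hk) H) (proj2 Hm)). lra.
Qed.

Lemma sqrt_sum_sqr k : 0 < k < 1 ->
  (sqrt (1 - k) + sqrt (1 + k)) ^ 2 = 2 * (1 + comp_modulus k).
Proof.
  intros Hk. unfold comp_modulus.
  replace (1 - k ^ 2) with ((1 - k) * (1 + k)) by ring.
  rewrite sqrt_mult by lra.
  replace ((sqrt (1 - k) + sqrt (1 + k)) ^ 2) with
    (sqrt (1 - k) ^ 2 + sqrt (1 + k) ^ 2 + 2 * (sqrt (1 - k) * sqrt (1 + k))) by ring.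
  rewrite !pow2_sqrt by lra. ring.
Qed.

(** By the arithmetic step, phi(q^2)^2 is the mean of thA and thB, that is
    thA (1 + k') / 2; and (sqrt (1-k) + sqrt (1+k))^2 is 2 (1 + k'). *)
Lemma lam_nome k : 0 < k < 1 ->
  lam (nome k) = ellK k * (sqrt (1 - k) + sqrt (1 + k)) / PI.
Proof.
  intros Hk. assert (Hq := nome_range k Hk). assert (HP := PI_RGT_0).
  assert (HA := thA_pos _ Hq). assert (Hm := theta_modulus_nome k Hk).
  assert (HK := ellK_pos k Hk).
  assert (Hc : comp_modulus k = thB (nome k) / thA (nome k))
    by (rewrite <- Hm at 1; now apply theta_comp_modulus).
  assert (EK : ellK k = thA (nome k) * (PI / 2)).
  { rewrite ellK_period, Hc, theta_ellI, ellI_AB by (trivial; now apply thB_pos). trivial. }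
  rewrite lam_eq by trivial.
  assert (Hs : 0 < sqrt (1 - k) + sqrt (1 + k))
    by (apply Rplus_lt_0_compat; apply sqrt_lt_R0; lra).
  assert (Hl : 0 <= phi (nome k) * phi (nome k ^ 2))
    by (left; apply Rmult_lt_0_compat; apply phi_pos; trivial; now apply (pow_range _ 1)).
  assert (Hr : 0 <= ellK k * (sqrt (1 - k) + sqrt (1 + k)) / PI)
    by (left; apply Rdiv_lt_0_compat; trivial; now apply Rmult_lt_0_compat).
  apply Rsqr_inj; trivial. rewrite !Rsqr_pow2.
  replace ((ellK k * (sqrt (1 - k) + sqrt (1 + k)) / PI) ^ 2)
    with (ellK k ^ 2 * (sqrt (1 - k) + sqrt (1 + k)) ^ 2 / PI ^ 2) by (field; lra).
  rewrite sqrt_sum_sqr, EK, Hc by trivial. rewrite Rpow_mult_distr.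
  fold (thA (nome k)). fold (thA (nome k ^ 2)). rewrite thA_agm by trivial.
  field. split; lra.
Qed.

(** * Derivatives with respect to the modulus *)

Definition dK_integrand (k t : R) : R :=
  k * sin t ^ 2 * / (delta2 k t * sqrt (delta2 k t)).

Lemma ellK_integrand_derive k t : k ^ 2 < 1 ->
  is_derive (fun k => 1 / sqrt (1 - k ^ 2 * sin t ^ 2)) k (dK_integrand k t).
Proof.
  intros Hk. assert (H := delta2_pos k t Hk). assert (Hs := sqrt_lt_R0 _ H).
  unfold dK_integrand. unfold delta2 in *.
  auto_derive; replace (1 + - (k * (k * 1) * (sin t * (sin t * 1))))
    with (1 - k ^ 2 * sin t ^ 2) by ring.
  - repeat split; trivial; lra.
  - set (D := 1 - k ^ 2 * sin t ^ 2) in *.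
    assert (HD : sqrt D * sqrt D = D) by (apply sqrt_sqrt; lra).
    set (r := sqrt D) in *. clearbody r. rewrite <- HD. field. lra.
Qed.

Lemma delta2_continuity_2d k t : continuity_2d_pt delta2 k t.
Proof.
  unfold delta2.
  apply continuity_2d_pt_minus; [apply continuity_2d_pt_const|].
  apply continuity_2d_pt_mult.
  - apply (continuity_1d_2d_pt_comp (fun x => x ^ 2) (fun u _ => u)).
    + apply derivable_continuous_pt, derivable_pt_pow.
    + apply continuity_2d_pt_id1.
  - apply (continuity_1d_2d_pt_comp (fun x => sin x ^ 2) (fun _ v => v)).
    + apply derivable_continuous_pt. apply (derivable_pt_comp sin (fun x => x ^ 2)).
      * apply derivable_pt_sin.
      * apply derivable_pt_pow.
    + apply continuity_2d_pt_id2.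
Qed.

Lemma dK_continuity_2d k t : k ^ 2 < 1 -> continuity_2d_pt dK_integrand k t.
Proof.
  intros Hk. assert (H := delta2_pos k t Hk). assert (Hs := sqrt_lt_R0 _ H).
  unfold dK_integrand.
  apply continuity_2d_pt_mult.
  - apply continuity_2d_pt_mult; [apply continuity_2d_pt_id1|].
    apply (continuity_1d_2d_pt_comp (fun x => sin x ^ 2) (fun _ v => v)).
    + apply derivable_continuous_pt. apply (derivable_pt_comp sin (fun x => x ^ 2)).
      * apply derivable_pt_sin.
      * apply derivable_pt_pow.
    + apply continuity_2d_pt_id2.
  - apply continuity_2d_pt_inv.
    + apply continuity_2d_pt_mult; [apply delta2_continuity_2d|].
      apply (continuity_1d_2d_pt_comp sqrt delta2).
      * apply continuity_pt_sqrt. lra.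
      * apply delta2_continuity_2d.
    + apply Rgt_not_eq. now apply Rmult_lt_0_compat.
Qed.

Lemma ellK_integrand_ex k x y : k ^ 2 < 1 ->
  ex_RInt (fun t => 1 / sqrt (1 - k ^ 2 * sin t ^ 2)) x y.
Proof.
  intros Hk. apply (ex_RInt_continuous (V := R_CompleteNormedModule)). intros t _.
  assert (H := delta2_pos k t Hk). assert (Hs := sqrt_lt_R0 _ H). unfold delta2 in *.
  apply (ex_derive_continuous (fun t => 1 / sqrt (1 - k ^ 2 * sin t ^ 2))).
  simpl in *. auto_derive.
  repeat split; trivial; unfold Rminus in *; lra.
Qed.

Lemma ellE_integrand_ex k x y : k ^ 2 < 1 ->
  ex_RInt (fun t => sqrt (1 - k ^ 2 * sin t ^ 2)) x y.
Proof.
  intros Hk. apply (ex_RInt_continuous (V := R_CompleteNormedModule)). intros t _.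
  assert (H := delta2_pos k t Hk). assert (Hs := sqrt_lt_R0 _ H). unfold delta2 in *.
  apply (ex_derive_continuous (fun t => sqrt (1 - k ^ 2 * sin t ^ 2))).
  simpl in *. auto_derive.
  repeat split; trivial; unfold Rminus in *; lra.
Qed.

Lemma locally_range k : 0 < k < 1 -> locally k (fun u => 0 < u < 1).
Proof.
  intros Hk. apply (open_and (fun u => 0 < u) (fun u => u < 1)); trivial.
  - apply open_gt.
  - apply open_lt.
Qed.

Lemma ellK_derive_RInt k : 0 < k < 1 ->
  is_derive ellK k (RInt (dK_integrand k) 0 (PI / 2)).
Proof.
  intros Hk. unfold ellK.
  assert (Hloc := locally_range k Hk).
  assert (Hd : forall u t, 0 < u < 1 ->
    Derive (fun z => 1 / sqrt (1 - z ^ 2 * sin t ^ 2)) u = dK_integrand u t).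
  { intros u t Hu. apply is_derive_unique, ellK_integrand_derive. now apply sqr_lt_1. }
  rewrite <- (RInt_ext (fun t => Derive (fun u => 1 / sqrt (1 - u ^ 2 * sin t ^ 2)) k))
    by (intros t _; now apply Hd).
  apply (is_derive_RInt_param (fun k t => 1 / sqrt (1 - k ^ 2 * sin t ^ 2)) 0 (PI / 2) k).
  - revert Hloc. apply filter_imp. intros u Hu t _. eexists.
    apply ellK_integrand_derive. now apply sqr_lt_1.
  - intros t _. apply continuity_2d_pt_ext_loc with dK_integrand.
    + destruct Hloc as [d Hd']. exists d. intros u v Hu _. symmetry. now apply Hd, Hd'.
    + apply dK_continuity_2d. now apply sqr_lt_1.
  - revert Hloc. apply filter_imp. intros u Hu. now apply ellK_integrand_ex, sqr_lt_1.
Qed.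

(** Up to the derivative of sin cos / Delta, which integrates to 0, the integrand is a
    combination of Delta and 1 / Delta. *)
Lemma dK_eval k : 0 < k < 1 ->
  RInt (dK_integrand k) 0 (PI / 2) = (ellE k + (k ^ 2 - 1) * ellK k) / (k * (1 - k ^ 2)).
Proof.
  intros Hk. assert (Hk2 := sqr_lt_1 k Hk).
  assert (Hp : forall t, 0 < 1 - k ^ 2 * sin t ^ 2) by (intros; now apply delta2_pos).
  set (w := fun t => (cos t ^ 2 - sin t ^ 2) / sqrt (delta2 k t)
    + k ^ 2 * sin t ^ 2 * cos t ^ 2 / (delta2 k t * sqrt (delta2 k t))).
  set (W := fun t => sin t * cos t / sqrt (1 - k ^ 2 * sin t ^ 2)).
  assert (Hw : is_RInt w 0 (PI / 2) 0).
  { replace 0 with (minus (W (PI / 2)) (W 0)) at 2.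
    - apply (is_RInt_derive (V := R_CompleteNormedModule) W w).
      + intros t _. specialize (Hp t). assert (Hs := sqrt_lt_R0 _ Hp).
        unfold W, w, delta2.
        auto_derive; replace (1 + - (k * (k * 1) * (sin t * (sin t * 1))))
          with (1 - k ^ 2 * sin t ^ 2) by ring.
        * repeat split; trivial; lra.
        * set (D := 1 - k ^ 2 * sin t ^ 2) in *.
          assert (HD : sqrt D * sqrt D = D) by (apply sqrt_sqrt; lra).
          set (r := sqrt D) in *. clearbody r. rewrite <- HD. field. lra.
      + intros t _. specialize (Hp t). assert (Hs := sqrt_lt_R0 _ Hp).
        apply (ex_derive_continuous w). unfold w, delta2. simpl in *.
        assert (0 < (1 - k * (k * 1) * (sin t * (sin t * 1))) *
          sqrt (1 - k * (k * 1) * (sin t * (sin t * 1)))) by now apply Rmult_lt_0_compat.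
        auto_derive. unfold Rminus in *. repeat split; trivial; lra.
    - unfold W, minus, plus, opp; simpl. rewrite cos_PI2, sin_0. unfold Rdiv. ring. }
  assert (HE := RInt_correct (V := R_CompleteNormedModule) _ _ _
    (ellE_integrand_ex k 0 (PI / 2) (proj2 Hk2))).
  assert (HK := RInt_correct (V := R_CompleteNormedModule) _ _ _
    (ellK_integrand_ex k 0 (PI / 2) (proj2 Hk2))).
  fold (ellE k) in HE. fold (ellK k) in HK.
  apply (is_RInt_scal _ _ _ (/ (k * (1 - k ^ 2)))) in HE.
  apply (is_RInt_scal _ _ _ (- / k)) in HK.
  apply (is_RInt_scal _ _ _ (- (k / (1 - k ^ 2)))) in Hw.
  assert (H := is_RInt_plus _ _ _ _ _ _ (is_RInt_plus _ _ _ _ _ _ HE HK) Hw).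
  apply is_RInt_unique in H.
  assert (E : / (k * (1 - k ^ 2)) * ellE k + - / k * ellK k + - (k / (1 - k ^ 2)) * 0
    = (ellE k + (k ^ 2 - 1) * ellK k) / (k * (1 - k ^ 2))) by (field; lra).
  rewrite <- E. clear E.
  etransitivity; [|exact H]. clear H.
  apply RInt_ext. intros t _. specialize (Hp t).
  unfold plus, scal; simpl; unfold mult; simpl.
  assert (Hs := sqrt_lt_R0 _ Hp). unfold dK_integrand, w.
  replace (1 - k * (k * 1) * (sin t * (sin t * 1))) with (1 - k ^ 2 * sin t ^ 2) by ring.
  replace (1 - k * (k * 1)) with (1 - k ^ 2) by ring.
  unfold delta2. rewrite !cos_sqr.
  set (D := 1 - k ^ 2 * sin t ^ 2) in *.
  assert (HD : sin t ^ 2 = (1 - D) / k ^ 2) by (unfold D; field; lra).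
  assert (HSD : sqrt D * sqrt D = D) by (apply sqrt_sqrt; lra).
  set (r := sqrt D) in *. clearbody r.
  rewrite HD. rewrite <- HSD. field. repeat split; lra.
Qed.

Lemma ellK_derive k : 0 < k < 1 ->
  is_derive ellK k ((ellE k + (k ^ 2 - 1) * ellK k) / (k * (1 - k ^ 2))).
Proof. intros Hk. rewrite <- dK_eval by trivial. now apply ellK_derive_RInt. Qed.

Lemma ellE_gt k : 0 < k < 1 -> (1 - k ^ 2) * ellK k < ellE k.
Proof.
  intros Hk. assert (Hk2 := sqr_lt_1 k Hk). assert (HP := PI_RGT_0).
  unfold ellK, ellE.
  rewrite <- (RInt_scal (V := R_CompleteNormedModule) _ 0 (PI / 2) (1 - k ^ 2))
    by now apply ellK_integrand_ex.
  assert (Hc : forall t, continuous (fun t => sqrt (1 - k ^ 2 * sin t ^ 2)) t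
    /\ continuous (fun t => scal (1 - k ^ 2) (1 / sqrt (1 - k ^ 2 * sin t ^ 2))) t).
  { intros t. assert (H := delta2_pos k t (proj2 Hk2)). assert (Hs := sqrt_lt_R0 _ H).
    unfold delta2 in *. split.
    - apply (ex_derive_continuous (fun t => sqrt (1 - k ^ 2 * sin t ^ 2))).
      simpl in *. auto_derive. repeat split; trivial; unfold Rminus in *; lra.
    - apply (ex_derive_continuous (fun t => (1 - k ^ 2) * (1 / sqrt (1 - k ^ 2 * sin t ^ 2)))).
      simpl in *. auto_derive. repeat split; trivial; unfold Rminus in *; lra. }
  apply RInt_lt; [lra|intros x _; exact (proj1 (Hc x))|intros x _; exact (proj2 (Hc x))|].
  intros t Ht. assert (H := delta2_pos k t (proj2 Hk2)). unfold delta2 in H.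
  assert (Hs := sqrt_lt_R0 _ H).
  change ((1 - k ^ 2) * (1 / sqrt (1 - k ^ 2 * sin t ^ 2)) < sqrt (1 - k ^ 2 * sin t ^ 2)).
  apply (Rmult_lt_reg_r (sqrt (1 - k ^ 2 * sin t ^ 2))); trivial.
  rewrite sqrt_sqrt by lra.
  replace ((1 - k ^ 2) * (1 / sqrt (1 - k ^ 2 * sin t ^ 2)) * sqrt (1 - k ^ 2 * sin t ^ 2))
    with (1 - k ^ 2) by (field; lra).
  assert (0 < cos t) by (apply cos_gt_0; lra).
  assert (0 < cos t ^ 2) by now apply pow_lt.
  assert (0 < k ^ 2 * cos t ^ 2) by (apply Rmult_lt_0_compat; lra).
  assert (E : k ^ 2 * cos t ^ 2 = k ^ 2 - k ^ 2 * sin t ^ 2) by (rewrite cos_sqr; ring).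
  lra.
Qed.

(** This quantity is the constant PI / 2 of Legendre; its positivity already follows
    from E > k'^2 K applied to both moduli. *)
Lemma legendre_pos k : 0 < k < 1 ->
  0 < ellE (comp_modulus k) * ellK k + (ellE k - ellK k) * ellK (comp_modulus k).
Proof.
  intros Hk. assert (Hc := comp_modulus_range k Hk).
  assert (H1 := ellE_gt k Hk). assert (H2 := ellE_gt _ Hc).
  rewrite comp_modulus_sqr in H2 by trivial.
  assert (HK := ellK_pos k Hk). assert (HK' := ellK_pos _ Hc).
  set (K := ellK k) in *. set (K' := ellK (comp_modulus k)) in *.
  assert (H3 : (1 - (1 - k ^ 2)) * K' * K < ellE (comp_modulus k) * K)
    by now apply Rmult_lt_compat_r.
  assert (H4 : (1 - k ^ 2) * K * K' < ellE k * K') by now apply Rmult_lt_compat_r.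
  nra.
Qed.

Lemma ratio_derive k : 0 < k < 1 ->
  is_derive ratio k
    (- (ellE (comp_modulus k) * ellK k + (ellE k - ellK k) * ellK (comp_modulus k))
      / (k * (1 - k ^ 2) * ellK k ^ 2)).
Proof.
  intros Hk. assert (Hc := comp_modulus_range k Hk). assert (Hk2 := sqr_lt_1 k Hk).
  assert (HK := ellK_pos k Hk).
  assert (D1 := ellK_derive k Hk). assert (D2 := ellK_derive _ Hc).
  assert (D3 : is_derive comp_modulus k (- k / comp_modulus k)).
  { unfold comp_modulus in *. auto_derive; [simpl in *; lra|].
    replace (1 + - (k * (k * 1))) with (1 - k ^ 2) by ring. field. lra. }
  assert (D4 := is_derive_comp ellK comp_modulus k _ _ D2 D3).
  assert (D5 := is_derive_div (fun k => ellK (comp_modulus k)) ellK k _ _ D4 D1 ltac:(lra)).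
  unfold ratio. replace (- _ / _) with
   ((- k / comp_modulus k *
       ((ellE (comp_modulus k) + (comp_modulus k ^ 2 - 1) * ellK (comp_modulus k)) /
        (comp_modulus k * (1 - comp_modulus k ^ 2))) * ellK k
     - ellK (comp_modulus k) * ((ellE k + (k ^ 2 - 1) * ellK k) / (k * (1 - k ^ 2)))) /
    ellK k ^ 2); [exact D5|].
  assert (Hsq := comp_modulus_sqr k Hk). rewrite Hsq.
  set (c := comp_modulus k) in *.
  replace (- k / c * ((ellE c + (1 - k ^ 2 - 1) * ellK c) / (c * (1 - (1 - k ^ 2)))))
    with (- (ellE c + (1 - k ^ 2 - 1) * ellK c) / (k * c ^ 2)) by (field; lra).
  rewrite Hsq. field. repeat split; lra.
Qed.

(** * Termwise differentiation *)

Lemma ex_series_geom_bound (a : nat -> R) C p : 0 <= p < 1 ->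
  (forall n, Rabs (a n) <= C * p ^ n) -> ex_series a.
Proof.
  intros Hp Ha.
  apply (ex_series_le (V := R_CompleteNormedModule) a (fun n => C * p ^ n)); [exact Ha|].
  apply (ex_series_scal_l C (fun n => p ^ n)). apply ex_series_geom. rewrite Rabs_right; lra.
Qed.

Lemma Series_tail_geom (a : nat -> R) C p N : 0 <= p < 1 ->
  (forall n, Rabs (a n) <= C * p ^ n) ->
  Rabs (Series a - sum_f_R0 a N) <= C * p ^ S N / (1 - p).
Proof.
  intros Hp Ha.
  assert (Hex := ex_series_geom_bound a C p Hp Ha).
  rewrite (Series_incr_n a (S N)) by (trivial; lia). simpl Nat.pred.
  replace (_ - _) with (Series (fun k => a (S N + k)%nat)) by ring.
  assert (Hb : forall n, Rabs (a (S N + n)%nat) <= C * p ^ S N * p ^ n).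
  { intros n. rewrite Rmult_assoc, <- pow_add. apply Ha. }
  assert (Hg : ex_series (fun n => C * p ^ S N * p ^ n)).
  { apply (ex_series_scal_l (C * p ^ S N) (fun n => p ^ n)). apply ex_series_geom.
    rewrite Rabs_right; lra. }
  eapply Rle_trans; [apply Series_Rabs|].
  - apply (ex_series_le (V := R_CompleteNormedModule) _
      (fun n => C * p ^ S N * p ^ n)); trivial.
    intros n. unfold norm; simpl; unfold abs; simpl. rewrite Rabs_Rabsolu. apply Hb.
  - eapply Rle_trans; [apply (Series_le _ (fun n => C * p ^ S N * p ^ n)); trivial|].
    + intros n. split; [apply Rabs_pos|apply Hb].
    + rewrite Series_scal_l, Series_geom by (rewrite Rabs_right; lra). right. reflexivity.
Qed.

(** The geometric bound on the derivatives makes the derived series converge uniformly. *)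
Lemma series_derive (f f' : nat -> R -> R) (F : R -> R) (c : R) (r : posreal) C p :
  0 <= p < 1 ->
  (forall y n, Boule c r y -> is_derive (f n) y (f' n y)) ->
  (forall y n, Boule c r y -> continuity_pt (f' n) y) ->
  (forall y n, Boule c r y -> Rabs (f' n y) <= C * p ^ n) ->
  (forall y, Boule c r y -> is_series (fun n => f n y) (F y)) ->
  is_derive F c (Series (fun n => f' n c)).
Proof.
  intros Hp Hd Hc Hb Hs. apply is_derive_Reals.
  assert (Hcont : forall N y, Boule c r y ->
    continuity_pt (fun y => sum_f_R0 (fun n => f' n y) N) y).
  { intros N y Hy. induction N as [|N IH]; simpl; [now apply Hc|].
    apply continuity_pt_plus; trivial. now apply Hc. }
  assert (Hcvu : CVU (fun N y => sum_f_R0 (fun n => f' n y) N)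
    (fun y => Series (fun n => f' n y)) c r).
  { intros eps He.
    assert (Hl : is_lim_seq (fun N => C * p ^ S N / (1 - p)) 0).
    { replace (Finite 0) with (Finite (C * 0 / (1 - p))) by (f_equal; field; lra).
      apply is_lim_seq_div'; [|apply is_lim_seq_const|lra].
      apply (is_lim_seq_scal_l (fun N => p ^ S N) C 0).
      apply (is_lim_seq_incr_1 (fun N => p ^ N)). apply is_lim_seq_geom.
      rewrite Rabs_right; lra. }
    apply is_lim_seq_spec in Hl. destruct (Hl (mkposreal eps He)) as (N & HN).
    exists N. intros n y Hn Hy. specialize (HN n Hn). simpl pos in HN.
    eapply Rle_lt_trans; [apply (Series_tail_geom _ C p); trivial; intros; now apply Hb|].
    rewrite Rminus_0_r in HN. eapply Rle_lt_trans; [apply Rle_abs|exact HN]. }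
  apply (derivable_pt_lim_CVU (fun N y => sum_f_R0 (fun n => f n y) N)
    (fun N y => sum_f_R0 (fun n => f' n y) N) F
    (fun y => Series (fun n => f' n y)) c c r); trivial.
  - unfold Boule. rewrite Rminus_diag, Rabs_R0. apply cond_pos.
  - intros y N Hy. apply is_derive_Reals. induction N as [|N IH]; simpl; [now apply Hd|].
    apply (is_derive_plus (fun y => sum_f_R0 (fun n => f n y) N) (f (S N))); trivial.
    now apply Hd.
  - intros y Hy. apply is_series_Reals. now apply Hs.
  - intros y Hy. apply (CVU_continuity _ _ c r Hcvu); trivial.
Qed.

Definition lambert_term (n : nat) (t : R) : R :=
  2 * chi n * (exp (- (PI * t)) ^ (2 * n + 1) / (1 - exp (- (PI * t)) ^ (2 * n + 1))).

Definition csch_term (t : R) (n : nat) : R :=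
  chi n * INR (2 * n + 1) * csch (INR (2 * n + 1) / 2 * t * PI) ^ 2.

Lemma csch_sqr x : 0 < x -> csch x ^ 2 = 4 * (exp (- (2 * x)) / (1 - exp (- (2 * x))) ^ 2).
Proof.
  intros Hx. assert (Hu := exp_neg_range _ Hx). assert (Hv := exp_neg_range (2 * x) ltac:(lra)).
  unfold csch, sinh.
  replace (- (2 * x)) with (- x + - x) in * by ring. rewrite exp_plus in *.
  replace (exp x) with (/ exp (- x)) by (rewrite exp_Ropp, Rinv_inv; trivial).
  set (u := exp (- x)) in *. clearbody u. field. split; lra.
Qed.

Lemma exp_pow x n : exp x ^ n = exp (INR n * x).
Proof.
  induction n as [|n IH]; [now rewrite Rmult_0_l, exp_0|].
  rewrite S_INR. simpl pow. rewrite IH, <- exp_plus. f_equal. ring.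
Qed.

Lemma lambert_pow t n : exp (- (PI * t)) ^ (2 * n + 1)
  = exp (- (2 * (INR (2 * n + 1) / 2 * t * PI))).
Proof. rewrite exp_pow. f_equal. field. Qed.

Lemma odd_arg_pos t n : 0 < t -> 0 < INR (2 * n + 1) / 2 * t * PI.
Proof.
  intros Ht. assert (HP := PI_RGT_0).
  assert (0 < INR (2 * n + 1)) by (apply lt_0_INR; lia).
  apply Rmult_lt_0_compat; [apply Rmult_lt_0_compat|]; lra.
Qed.

Lemma csch_term_alt t n : 0 < t -> csch_term t n
  = 4 * chi n * INR (2 * n + 1)
    * (exp (- (PI * t)) ^ (2 * n + 1) / (1 - exp (- (PI * t)) ^ (2 * n + 1)) ^ 2).
Proof.
  intros Ht. unfold csch_term. rewrite csch_sqr by now apply odd_arg_pos.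
  rewrite <- lambert_pow. ring.
Qed.

Lemma lambert_term_derive n t : 0 < t ->
  is_derive (lambert_term n) t (- (PI / 2) * csch_term t n).
Proof.
  intros Ht. rewrite csch_term_alt by trivial.
  assert (H := odd_arg_pos t n Ht).
  assert (He := exp_neg_range (2 * (INR (2 * n + 1) / 2 * t * PI)) ltac:(lra)).
  apply is_derive_ext with (fun t => 2 * chi n *
    (exp (- (2 * (INR (2 * n + 1) / 2 * t * PI)))
      / (1 - exp (- (2 * (INR (2 * n + 1) / 2 * t * PI)))))).
  - intros u. unfold lambert_term. now rewrite lambert_pow.
  - rewrite lambert_pow. set (m := INR (2 * n + 1)) in *. clearbody m. auto_derive.
    + lra.
    + set (e := exp _) in *. clearbody e. field. lra.
Qed.

(** Bernoulli's inequality applied to 1/s. *)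
Lemma odd_pow_bound s m : 0 < s < 1 -> INR m * s ^ m <= / (1 - s).
Proof.
  intros Hs.
  assert (H := poly m (/ s - 1)).
  assert (Hi : 0 < / s - 1).
  { assert (1 < / s) by (rewrite <- Rinv_1; apply Rinv_lt_contravar; lra). lra. }
  specialize (H Hi). replace (1 + (/ s - 1)) with (/ s) in H by ring.
  rewrite pow_inv in H. assert (Hp : 0 < s ^ m) by (apply pow_lt; lra).
  apply (Rmult_le_compat_r (s ^ m * s)) in H; [|left; apply Rmult_lt_0_compat; lra].
  replace (/ s ^ m * (s ^ m * s)) with s in H by (field; lra).
  replace ((1 + INR m * (/ s - 1)) * (s ^ m * s)) with
    (s ^ m * s + INR m * s ^ m * (1 - s)) in H by (field; lra).
  assert (0 < s ^ m * s) by (apply Rmult_lt_0_compat; lra).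
  apply (Rmult_le_reg_r (1 - s)); [lra|]. rewrite Rinv_l by lra. lra.
Qed.

(** For s^2 = exp (- PI t0) the terms are at most a constant times m s^(2m), and one of
    the two powers of s absorbs the factor m. *)
Lemma csch_term_bound t0 : 0 < t0 -> exists C p, 0 <= p < 1 /\
  forall t n, t0 < t -> Rabs (- (PI / 2) * csch_term t n) <= C * p ^ n.
Proof.
  intros Ht0. assert (HP := PI_RGT_0).
  set (s := exp (- (PI * t0 / 2))).
  assert (Hs : 0 < s < 1) by (apply exp_neg_range; nra).
  exists (PI / 2 * (4 * (/ (1 - s) * / (1 - s) ^ 2))), s. split; [lra|].
  intros t n Ht. rewrite csch_term_alt by lra.
  set (m := (2 * n + 1)%nat).
  assert (Hx0 : 0 < exp (- (PI * t))) by apply exp_pos.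
  assert (Hx : exp (- (PI * t)) <= s * s).
  { unfold s. rewrite <- exp_plus. left. apply exp_increasing. nra. }
  set (x := exp (- (PI * t))) in *. clearbody x.
  assert (Hxs : x <= s) by nra.
  assert (Hm0 : 0 <= INR m) by apply pos_INR.
  assert (Hxm : 0 < x ^ m) by now apply pow_lt.
  assert (Hxm1 : x ^ m <= s).
  { apply Rle_trans with (x ^ 1); [|simpl; lra]. apply pow_le_pow; [lra|]. unfold m; lia. }
  rewrite !Rabs_mult, chi_abs, (Rabs_right 4), (Rabs_right (INR m)) by lra.
  rewrite Rabs_Ropp, (Rabs_right (PI / 2)) by lra.
  rewrite Rabs_right.
  2:{ apply Rle_ge, Rlt_le, Rdiv_lt_0_compat; trivial. apply pow_lt. lra. }
  rewrite !Rmult_assoc. apply Rmult_le_compat_l; [lra|].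
  apply Rmult_le_compat_l; [lra|]. rewrite Rmult_1_l.
  unfold Rdiv. rewrite <- Rmult_assoc.
  replace (/ (1 - s) * (/ (1 - s) ^ 2 * s ^ n)) with (/ (1 - s) * s ^ n * / (1 - s) ^ 2) by ring.
  apply Rmult_le_compat.
  - apply Rmult_le_pos; lra.
  - left. apply Rinv_0_lt_compat, pow_lt. lra.
  - apply Rle_trans with (INR m * s ^ m * s ^ n).
    + rewrite Rmult_assoc. apply Rmult_le_compat_l; trivial.
      apply Rle_trans with ((s * s) ^ m); [apply pow_incr; lra|].
      rewrite Rpow_mult_distr. apply Rmult_le_compat_l; [apply pow_le; lra|].
      apply pow_le_pow; trivial. unfold m; lia.
    + apply Rmult_le_compat_r; [apply pow_le; lra|]. now apply odd_pow_bound.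
  - apply Rinv_le_contravar; [apply pow_lt; lra|]. apply pow_incr. lra.
Qed.

Lemma csch_term_continuity n t : 0 < t -> continuity_pt (fun t => - (PI / 2) * csch_term t n) t.
Proof.
  intros Ht. assert (H := odd_arg_pos t n Ht).
  assert (Hsh : 0 < sinh (INR (2 * n + 1) / 2 * t * PI)).
  { rewrite <- sinh_0. now apply sinh_lt. }
  apply derivable_continuous_pt, ex_derive_Reals_0.
  unfold csch_term, csch, sinh in *. set (m := INR (2 * n + 1)) in *. clearbody m.
  auto_derive. lra.
Qed.

Lemma lam_exp_derive t : 0 < t ->
  is_derive (fun t => lam (exp (- (PI * t))) - 1) t
    (Series (fun n => - (PI / 2) * csch_term t n))
  /\ ex_series (fun n => - (PI / 2) * csch_term t n).
Proof.
  intros Ht. destruct (csch_term_bound (t / 2)) as (C & p & Hp & Hb); [lra|]. split.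
  - assert (Hr : 0 < t / 2) by lra.
    assert (HB : forall y, Boule t (mkposreal _ Hr) y -> t / 2 < y).
    { intros y Hy. unfold Boule in Hy. simpl in Hy. apply Rabs_lt_between in Hy. lra. }
    apply (series_derive lambert_term (fun n t => - (PI / 2) * csch_term t n)
      _ t (mkposreal _ Hr) C p Hp).
    + intros y n Hy. apply HB in Hy. apply lambert_term_derive. lra.
    + intros y n Hy. apply HB in Hy. apply csch_term_continuity. lra.
    + intros y n Hy. apply HB in Hy. now apply Hb.
    + intros y Hy. apply HB in Hy. apply lam_lambert. apply exp_neg_range.
      apply Rmult_lt_0_compat; [apply PI_RGT_0|lra].
  - apply (ex_series_geom_bound _ C p Hp). intros n. apply Hb. lra.
Qed.

(** * The sum of the hyperbolic series *)

(** The chain rule applied to [lam_nome], with [nome k] = exp (- PI [ratio k]). *)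
Lemma csch_series k : 0 < k < 1 ->
  is_series (csch_term (ratio k))
    ((2 * k * (k ^ 2 - 1) * ellK k ^ 2
      * ((sqrt (1 - k) + sqrt (1 + k)) * (ellE k + (k ^ 2 - 1) * ellK k)
           / (k * (k ^ 2 - 1))
         - 1 / 2 * (1 / sqrt (1 + k) - 1 / sqrt (1 - k)) * ellK k))
     / (PI ^ 2 * (ellE (comp_modulus k) * ellK k + (ellE k - ellK k) * ellK (comp_modulus k)))).
Proof.
  intros Hk. assert (HP := PI_RGT_0). assert (Hr := ratio_pos k Hk).
  assert (HK := ellK_pos k Hk). assert (HL := legendre_pos k Hk).
  assert (Hk2 := sqr_lt_1 k Hk).
  destruct (lam_exp_derive _ Hr) as (D1 & Hex).
  set (s := Series _) in *.
  assert (D2 := is_derive_comp _ ratio k _ _ D1 (ratio_derive k Hk)).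
  assert (D3 : is_derive (fun k => ellK k * (sqrt (1 - k) + sqrt (1 + k)) / PI - 1) k
    (((ellE k + (k ^ 2 - 1) * ellK k) / (k * (1 - k ^ 2)) * (sqrt (1 - k) + sqrt (1 + k))
      + ellK k * (1 / 2 * (1 / sqrt (1 + k) - 1 / sqrt (1 - k)))) / PI)).
  { assert (DK := ellK_derive k Hk).
    assert (DS : is_derive (fun k => sqrt (1 - k) + sqrt (1 + k)) k
      (1 / 2 * (1 / sqrt (1 + k) - 1 / sqrt (1 - k)))).
    { assert (S1 : 0 < sqrt (1 - k)) by (apply sqrt_lt_R0; lra).
      assert (S2 : 0 < sqrt (1 + k)) by (apply sqrt_lt_R0; lra).
      auto_derive; [split; [|split]; trivial; lra|].
      replace (1 + - k) with (1 - k) by ring. field. split; lra. }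
    assert (DM := is_derive_mult _ _ k _ _ DK DS Rmult_comm).
    apply (is_derive_scal _ _ (/ PI)) in DM.
    assert (DC := is_derive_minus _ _ k _ _ DM (is_derive_const (V := R_NormedModule) 1 k)).
    apply (is_derive_ext_loc _ (fun k => ellK k * (sqrt (1 - k) + sqrt (1 + k)) / PI - 1)) in DC.
    - replace (_ / PI) with (minus (/ PI * (plus
        (mult ((ellE k + (k ^ 2 - 1) * ellK k) / (k * (1 - k ^ 2)))
              (sqrt (1 - k) + sqrt (1 + k)))
        (mult (ellK k) (1 / 2 * (1 / sqrt (1 + k) - 1 / sqrt (1 - k)))))) zero); [exact DC|].
      unfold minus, plus, opp, mult, zero; simpl. field.
      repeat split; try lra; apply Rgt_not_eq, sqrt_lt_R0; lra.
    - apply filter_forall. intros x. unfold minus, plus, opp, mult; simpl. field. lra. }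
  apply (is_derive_ext_loc _ (fun k => lam (exp (- (PI * ratio k))) - 1)) in D3.
  2:{ apply (filter_imp (fun u => 0 < u < 1)); [|now apply locally_range].
      intros u Hu. now rewrite <- (lam_nome u Hu). }
  assert (E := eq_trans (eq_sym (is_derive_unique _ _ _ D2)) (is_derive_unique _ _ _ D3)).
  apply (Series_correct) in Hex. fold s in Hex.
  apply (is_series_scal_l (V := R_NormedModule) (- (2 / PI))) in Hex.
  match goal with |- is_series _ ?v => replace v with (- (2 / PI) * s) end.
  - eapply is_series_ext; [|exact Hex]. intros n.
    change (- (2 / PI) * (- (PI / 2) * csch_term (ratio k) n) = csch_term (ratio k) n).
    field. lra.
  - change (- (ellE (comp_modulus k) * ellK k + (ellE k - ellK k) * ellK (comp_modulus k))
      / (k * (1 - k ^ 2) * ellK k ^ 2) * s =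
      ((ellE k + (k ^ 2 - 1) * ellK k) / (k * (1 - k ^ 2)) * (sqrt (1 - k) + sqrt (1 + k))
      + ellK k * (1 / 2 * (1 / sqrt (1 + k) - 1 / sqrt (1 - k)))) / PI) in E.
    assert (S1 : 0 < sqrt (1 - k)) by (apply sqrt_lt_R0; lra).
    assert (S2 : 0 < sqrt (1 + k)) by (apply sqrt_lt_R0; lra).
    set (L := ellE (comp_modulus k) * ellK k + (ellE k - ellK k) * ellK (comp_modulus k)) in *.
    assert (Es : s = - (k * (1 - k ^ 2) * ellK k ^ 2) / L *
      (((ellE k + (k ^ 2 - 1) * ellK k) / (k * (1 - k ^ 2)) * (sqrt (1 - k) + sqrt (1 + k))
      + ellK k * (1 / 2 * (1 / sqrt (1 + k) - 1 / sqrt (1 - k)))) / PI)).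
    { rewrite <- E. field. repeat split; lra. }
    rewrite Es. clearbody L. field. repeat split; lra.
Qed.

Theorem theorem4 : forall k : R, 0 < k ^ 2 < 1 ->
  let K := ellK k in
  let E := ellE k in
  let K' := ellK (comp_modulus k) in
  let E' := ellE (comp_modulus k) in
  is_series
    (fun n : nat =>
       (-1) ^ (n / 2)%nat * INR (2 * n + 1)
       * csch (INR (2 * n + 1) / 2 * (K' / K) * PI) ^ 2)
    ((2 * k * (k ^ 2 - 1) * K ^ 2
      * ((sqrt (1 - k) + sqrt (1 + k)) * (E + (k ^ 2 - 1) * K)
           / (k * (k ^ 2 - 1))
         - 1 / 2 * (1 / sqrt (1 + k) - 1 / sqrt (1 - k)) * K))
     / (PI ^ 2 * (E' * K + (E - K) * K'))).
Proof.
  intros k Hk K E K' E'.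
  assert (Hk1 : -1 < k < 1) by (simpl in Hk; nra).
  assert (Hk0 : k <> 0) by (intros ->; simpl in Hk; lra).
  destruct (Rlt_le_dec 0 k) as [H|H].
  - apply (csch_series k). lra.
  (* both sides are even in k *)
  - assert (Hm : 0 < - k < 1) by lra.
    assert (Hs := csch_series (- k) Hm). unfold csch_term, ratio in Hs.
    assert (Hsq : (- k) ^ 2 = k ^ 2) by ring.
    assert (EK : ellK (- k) = K) by (unfold K, ellK; now rewrite Hsq).
    assert (EE : ellE (- k) = E) by (unfold E, ellE; now rewrite Hsq).
    assert (Ec : comp_modulus (- k) = comp_modulus k) by (unfold comp_modulus; now rewrite Hsq).
    assert (HL := legendre_pos (- k) Hm).
    rewrite EK, EE, Ec in *. rewrite Hsq in Hs. fold K' in Hs, HL. fold E' in Hs, HL.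
    replace (1 - - k) with (1 + k) in Hs by ring.
    replace (1 + - k) with (1 - k) in Hs by ring.
    match type of Hs with is_series _ ?v => match goal with |- is_series _ ?w =>
      replace w with v; [exact Hs|] end end.
    assert (S1 : 0 < sqrt (1 - k)) by (apply sqrt_lt_R0; lra).
    assert (S2 : 0 < sqrt (1 + k)) by (apply sqrt_lt_R0; lra).
    assert (HP := PI_RGT_0).
    field. repeat split; lra.
Qed.
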